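(* Let $n\geq1$ and let $G$ be the $n$-circle graph $\mathscr{C}_n$. Then every derivation on $\mathcal{A}_G$ is inner, i.e. of the form $\delta_T$ for some $T\in\mathcal{A}_G$.
   Context: The $n$-circle graph $\mathscr{C}_n$ is the directed graph with distinct vertices $v_1,\dots,v_n$ and edges $e_1,\dots,e_n$ whose range and source are $r(e_j)=v_j$, $s(e_j)=v_{j+1\,(\mathrm{mod}\,n)}$. For a directed graph $G$ with vertex set $\mathcal{V}$ and edge set $\mathcal{E}$, $\mathbb{F}_G^+$ is the set of all directed paths of finite length: vertices $v$ are paths of length $0$ with $r(v)=s(v)=v$, and a path of length $k\geq1$ is $p=f_1f_2\cdots f_k$ (edges $f_i$) with $s(f_i)=r(f_{i+1})$, $r(p)=r(f_1)$, $s(p)=s(f_k)$; if $s(p_1)=r(p_2)$, the product $p_1p_2$ is the concatenation. Let $\mathcal{H}_G=\ell^2(\mathbb{F}_G^+)$ with orthonormal basis $\{\xi_w\}$. For $e\in\mathcal{E}$, $L_e\xi_w=\xi_{ew}$ if $r(w)=s(e)$ and $0$ otherwise; for $x\in\mathcal{V}$, $L_x\xi_w=\xi_w$ if $r(w)=x$ and $0$ otherwise. $\mathcal{A}_G$ is the norm-closed algebra generated by $\{L_e,L_x\colon e\in\mathcal{E},x\in\mathcal{V}\}$ in $B(\mathcal{H}_G)$. A derivation on $\mathcal{A}_G$ is a linear map $\delta\colon\mathcal{A}_G\to\mathcal{A}_G$ (not assumed bounded) with $\delta(AB)=\delta(A)B+A\delta(B)$; $\delta_T(A)=AT-TA$.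 *)

(* Defs.v *)
From HB Require Import structures.
From mathcomp Require Import all_boot all_order all_algebra.
From mathcomp Require Import all_classical all_reals ereal topology normedtype.
From mathcomp Require Import sequences esum.
From mathcomp Require Import ring complex.

Set Implicit Arguments.
Unset Strict Implicit.
Unset Printing Implicit Defensive.

Import Order.TTheory GRing.Theory Num.Theory.
Import numFieldNormedType.Exports.

Local Open Scope classical_set_scope.
Local Open Scope ring_scope.
Local Open Scope complex_scope.

(* A norm over R[i] takes its values in R[i]; rnorm is the same norm, read in R. *)
Definition rnorm (R : realType) (V : normedZmodType R[i]) (v : V) : R :=
  complex.Re `|v|.

Section rnorm_theory.
Variables (R : realType) (V : normedZmodType R[i]).
Implicit Types v w : V.

Lemma rnormE v : `|v| = (rnorm v)%:C.
Proof. by rewrite /rnorm RRe_real// normr_real. Qed.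

Lemma rnorm_ge0 v : 0 <= rnorm v.
Proof. by rewrite -lecR -rnormE normr_ge0. Qed.

Lemma ler_rnormD v w : rnorm (v + w) <= rnorm v + rnorm w.
Proof. by rewrite -lecR rmorphD/= -!rnormE ler_normD. Qed.

Lemma rnorm0 : rnorm (0 : V) = 0.
Proof. by rewrite /rnorm normr0. Qed.

Lemma rnorm0_eq0 v : rnorm v = 0 -> v = 0.
Proof. by move=> v0; apply/normr0_eq0; rewrite rnormE v0. Qed.

End rnorm_theory.

Lemma rnormM (R : realType) (a b : R[i]) : rnorm (a * b) = rnorm a * rnorm b.
Proof. by apply: complexI; rewrite rmorphM/= -!rnormE normrM. Qed.

Lemma rnormZ (R : realType) (V : normedModType R[i]) (a : R[i]) (v : V) :
  rnorm (a *: v) = rnorm a * rnorm v.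
Proof. by apply: complexI; rewrite rmorphM/= -!rnormE normrZ. Qed.

Section finite_sums.
Variables (R : realType) (I : choiceType).
Implicit Types (a b : I -> R) (s : seq I).

Lemma esum_leP a M : (forall i, 0 <= a i) ->
  (\esum_(i in [set: I]) (a i)%:E <= M%:E)%E <->
  (forall s, uniq s -> \sum_(i <- s) a i <= M).
Proof.
move=> a0; split=> [aM s us|aM].
  rewrite -lee_fin; apply: le_trans aM; rewrite -sumEFin fsbig_seq//.
  apply: ereal_sup_ubound; exists [set` s] => //.
apply: ge_ereal_sup => _ [A [Afin _] <-].
by rewrite fsbig_finite// sumEFin lee_fin aM.
Qed.

Lemma cauchy_schwarz_seq a b s :
  (forall i, 0 <= a i) -> (forall i, 0 <= b i) ->
  \sum_(i <- s) a i * b i <=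
  Num.sqrt (\sum_(i <- s) a i ^+ 2) * Num.sqrt (\sum_(i <- s) b i ^+ 2).
Proof.
move=> a0 b0.
have S0 c : 0 <= \sum_(i <- s) c i ^+ 2 :> R.
  by apply: sumr_ge0 => i _; exact: sqr_ge0.
set A := Num.sqrt _; set B := Num.sqrt _.
have A2 : A ^+ 2 = \sum_(i <- s) a i ^+ 2 by rewrite sqr_sqrtr.
have B2 : B ^+ 2 = \sum_(i <- s) b i ^+ 2 by rewrite sqr_sqrtr.
have vanish c d : \sum_(i <- s) c i ^+ 2 = 0 :> R -> \sum_(i <- s) c i * d i = 0.
  move=> /eqP; rewrite psumr_eq0; last by move=> i _; exact: sqr_ge0.
  move=> /allP c0; rewrite big_seq big1// => i /c0/=.
  by rewrite sqrf_eq0 => /eqP ->; rewrite mul0r.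
have [A0|A0] := eqVneq A 0.
  by rewrite vanish ?A0 ?mul0r// -A2 A0 expr0n.
have [B0|B0] := eqVneq B 0.
  under eq_bigr do rewrite mulrC.
  by rewrite vanish ?B0 ?mulr0// -B2 B0 expr0n.
have Ap : 0 < A by rewrite lt0r A0 sqrtr_ge0.
have Bp : 0 < B by rewrite lt0r B0 sqrtr_ge0.
have AB i : a i * b i <=
    A * B / 2 * (A ^- 2 * a i ^+ 2 + B ^- 2 * b i ^+ 2).
  have -> : A * B / 2 * (A ^- 2 * a i ^+ 2 + B ^- 2 * b i ^+ 2) =
      a i * b i + A * B / 2 * (a i / A - b i / B) ^+ 2.
    by field; rewrite ?A0 ?B0.
  by rewrite lerDl mulr_ge0 ?sqr_ge0// divr_ge0 ?mulr_ge0// ltW.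
apply: le_trans (ler_sum _ (fun i _ => AB i)) _.
rewrite -mulr_sumr big_split/= -!mulr_sumr -A2 -B2.
by rewrite !mulVf ?sqrf_eq0// -[1 + 1]/(2%:R) divfK// pnatr_eq0.
Qed.

Lemma minkowski_seq a b s :
  (forall i, 0 <= a i) -> (forall i, 0 <= b i) ->
  Num.sqrt (\sum_(i <- s) (a i + b i) ^+ 2) <=
  Num.sqrt (\sum_(i <- s) a i ^+ 2) + Num.sqrt (\sum_(i <- s) b i ^+ 2).
Proof.
move=> a0 b0.
have S0 c : 0 <= \sum_(i <- s) c i ^+ 2 :> R.
  by apply: sumr_ge0 => i _; exact: sqr_ge0.
rewrite -(ger0_norm (addr_ge0 (sqrtr_ge0 _) (sqrtr_ge0 _))) -sqrtr_sqr.
apply: ler_wsqrtr; rewrite sqrrD !sqr_sqrtr//.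
under eq_bigr do rewrite sqrrD.
rewrite !big_split/= lerD2r lerD2l mulr2n lerD//.
all: exact: cauchy_schwarz_seq.
Qed.

End finite_sums.

Definition l2_sum (R : realType) (I : choiceType) (f : I -> R[i]) : \bar R :=
  \esum_(i in [set: I]) (rnorm (f i) ^+ 2)%:E.

Definition square_summable (R : realType) (I : choiceType) :
  {pred I -> R[i]} := fun f => (l2_sum f < +oo)%E.

Record l2 (R : realType) (I : choiceType) := L2 {
  l2_fun :> I -> R[i];
  l2P : l2_fun \in @square_summable R I }.

Section l2_lmodule.
Variables (R : realType) (I : choiceType).
Local Notation C := R[i].
Implicit Types (f g : I -> C).

Lemma l2_sum_ge0 f : (0 <= l2_sum f)%E.
Proof. by apply: esum_ge0 => i _; rewrite lee_fin sqr_ge0. Qed.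

Lemma l2_sum_leP f M : (l2_sum f <= M%:E)%E <->
  (forall s : seq I, uniq s -> \sum_(i <- s) rnorm (f i) ^+ 2 <= M).
Proof. by apply: esum_leP => i; exact: sqr_ge0. Qed.

Lemma square_summableP f : f \in @square_summable R I <->
  exists M : R, forall s : seq I, uniq s -> \sum_(i <- s) rnorm (f i) ^+ 2 <= M.
Proof.
split=> [foo|[M /l2_sum_leP fM]]; last first.
  by apply: (le_lt_trans fM); exact: ltry.
exists (fine (l2_sum f)); apply/l2_sum_leP.
by rewrite fineK// ge0_fin_numE// l2_sum_ge0.
Qed.

Lemma square_summable_closed : GRing.subsemimod_closed (@square_summable R I).
Proof.
split; [split=> [|f g /square_summableP[M fM] /square_summableP[N gN]]|
  move=> c f /square_summableP[M fM]]; apply/square_summableP.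
- by exists 0 => s _; rewrite big1// => i _; rewrite rnorm0 expr0n.
- exists (2 * M + 2 * N) => s us.
  apply: le_trans (lerD (ler_wpM2l _ (fM s us)) (ler_wpM2l _ (gN s us))) => //.
  rewrite !mulr_sumr -big_split/=; apply: ler_sum => i _.
  apply: (@le_trans _ _ ((rnorm (f i) + rnorm (g i)) ^+ 2)).
    by rewrite ler_sqr ?nnegrE ?addr_ge0 ?rnorm_ge0// ler_rnormD.
  rewrite -subr_ge0 [leRHS](_ : _ = (rnorm (f i) - rnorm (g i)) ^+ 2); last ring.
  exact: sqr_ge0.
- exists (rnorm c ^+ 2 * M) => s us.
  apply: le_trans (ler_wpM2l (sqr_ge0 _) (fM s us)).
  rewrite mulr_sumr; apply: ler_sum => i _.
  by rewrite -exprMn -rnormM.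
Qed.

HB.instance Definition _ := [isSub for @l2_fun R I].
HB.instance Definition _ := [Choice of l2 R I by <:].
HB.instance Definition _ := GRing.SubChoice_isSubLmodule.Build
  C (I -> C) (@square_summable R I) (l2 R I) square_summable_closed.

Definition l2norm (f : l2 R I) : R := Num.sqrt (fine (l2_sum f)).

Implicit Types u v : l2 R I.

Lemma l2_eq u v : u =1 v -> u = v.
Proof. by move=> uv; apply/val_inj/funext. Qed.

Lemma l2_addE u v i : (u + v) i = u i + v i. Proof. by []. Qed.

Lemma l2_scaleE c u i : (c *: u) i = c * u i. Proof. by []. Qed.

Lemma l2_zeroE i : (0 : l2 R I) i = 0. Proof. by []. Qed.

Lemma l2_sumE u : l2_sum u = (l2norm u ^+ 2)%:E.
Proof.
rewrite sqr_sqrtr ?fine_ge0 ?l2_sum_ge0// fineK// ge0_fin_numE ?l2_sum_ge0//.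
exact: l2P.
Qed.

Lemma l2norm_ge0 u : 0 <= l2norm u. Proof. exact: sqrtr_ge0. Qed.

Lemma l2norm_leP u M : 0 <= M -> (l2norm u <= M <->
  (forall s : seq I, uniq s -> \sum_(i <- s) rnorm (u i) ^+ 2 <= M ^+ 2)).
Proof.
move=> M0; rewrite -l2_sum_leP l2_sumE lee_fin.
by rewrite ler_sqr// nnegrE l2norm_ge0.
Qed.

Lemma sum_le_l2norm u (s : seq I) : uniq s ->
  \sum_(i <- s) rnorm (u i) ^+ 2 <= l2norm u ^+ 2.
Proof. by move: s; exact/(l2norm_leP _ (l2norm_ge0 u)). Qed.

Lemma coord_le_l2norm u i : rnorm (u i) <= l2norm u.
Proof.
rewrite -ler_sqr ?nnegrE ?rnorm_ge0 ?l2norm_ge0//.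
by have := @sum_le_l2norm u [:: i] isT; rewrite big_seq1.
Qed.

Lemma l2normD u v : l2norm (u + v) <= l2norm u + l2norm v.
Proof.
apply/l2norm_leP => [|s us]; first by rewrite addr_ge0 ?l2norm_ge0.
have S0 (w : I -> R) : 0 <= \sum_(i <- s) w i ^+ 2.
  by apply: sumr_ge0 => i _; exact: sqr_ge0.
apply: (@le_trans _ _ (\sum_(i <- s) (rnorm (u i) + rnorm (v i)) ^+ 2)).
  apply: ler_sum => i _.
  by rewrite ler_sqr ?nnegrE ?addr_ge0 ?rnorm_ge0// ler_rnormD.
rewrite -[leLHS]sqr_sqrtr// ler_sqr ?nnegrE ?addr_ge0 ?sqrtr_ge0 ?l2norm_ge0//.
apply: le_trans (minkowski_seq _ _ _) _; try by move=> i; exact: rnorm_ge0.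
by apply: lerD; rewrite -[leRHS]ger0_norm ?l2norm_ge0// -sqrtr_sqr
  ler_wsqrtr// sum_le_l2norm.
Qed.

Lemma l2normZ_le c u : l2norm (c *: u) <= rnorm c * l2norm u.
Proof.
apply/l2norm_leP => [|s us]; first by rewrite mulr_ge0 ?rnorm_ge0 ?l2norm_ge0.
rewrite exprMn; apply: le_trans (ler_wpM2l (sqr_ge0 _) (sum_le_l2norm u us)).
by rewrite mulr_sumr; apply: ler_sum => i _; rewrite -exprMn -rnormM.
Qed.

Lemma l2norm0_eq0 u : l2norm u = 0 -> u = 0.
Proof.
move=> u0; apply: l2_eq => i; apply: rnorm0_eq0; apply/eqP.
by rewrite eq_le rnorm_ge0 andbT -u0 coord_le_l2norm.
Qed.

Lemma l2normZ c u : l2norm (c *: u) = rnorm c * l2norm u.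
Proof.
apply/eqP; rewrite eq_le l2normZ_le/=.
have [->|c0] := eqVneq c 0; first by rewrite rnorm0 mul0r l2norm_ge0.
rewrite -{1}(scalerK c0 u).
apply: le_trans (ler_wpM2l (rnorm_ge0 _) (l2normZ_le _ _)) _.
rewrite mulrA -rnormM divff// (_ : rnorm 1 = 1) ?mul1r//.
by rewrite /rnorm normr1.
Qed.

Let normC u : C := (l2norm u)%:C.

Let ler_normCD u v : normC (u + v) <= normC u + normC v.
Proof. by rewrite /normC -rmorphD/= lecR l2normD. Qed.

Let normCZ c u : normC (c *: u) = `|c| * normC u.
Proof. by rewrite /normC l2normZ rmorphM/= -rnormE. Qed.

Let normC0_eq0 u : normC u = 0 -> u = 0.
Proof. by move=> /complexI/l2norm0_eq0. Qed.

HB.instance Definition _ := Lmodule_isNormed.Build C (l2 R I)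
  ler_normCD normCZ normC0_eq0.

Lemma rnorm_l2 u : rnorm u = l2norm u. Proof. by []. Qed.

End l2_lmodule.

Definition bounded_linear (R : realType) (V : normedModType R[i]) :
  {pred V -> V} :=
  fun T => `[< linear T /\ exists M : R, forall v, rnorm (T v) <= M * rnorm v >].

Record bop (R : realType) (V : normedModType R[i]) := Bop {
  bop_fun :> V -> V;
  bopP : bop_fun \in @bounded_linear R V }.

Section bop_algebra.
Variables (R : realType) (V : normedModType R[i]).
Local Notation C := R[i].
Local Notation B := (@bop R V).

Lemma bounded_linear_closed : GRing.subsemimod_closed (@bounded_linear R V).
Proof.
split; [split=> [|S T /asboolP[Sl [M SM]] /asboolP[Tl [N TN]]]|
  move=> c T /asboolP[Tl [M TM]]]; apply/asboolP; split.
- by move=> a u v; rewrite -[RHS]/(a *: (0 : V) + 0) scaler0 addr0.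
- by exists 0 => v; rewrite -[X in rnorm X]/(0 : V) rnorm0 mul0r.
- move=> a u v; rewrite -[LHS]/(S _ + T _) -[RHS]/(a *: (S u + T u) + (S v + T v)).
  by rewrite Sl Tl scalerDr addrACA.
- exists (M + N) => v; apply: le_trans (ler_rnormD _ _) _.
  by rewrite mulrDl lerD.
- move=> a u v; rewrite -[LHS]/(c *: T _) -[RHS]/(a *: (c *: T u) + c *: T v).
  by rewrite Tl scalerDr !scalerA mulrC.
- exists (rnorm c * M) => v; rewrite -[X in rnorm X]/(c *: T v) rnormZ -mulrA.
  by rewrite ler_wpM2l ?rnorm_ge0.
Qed.

HB.instance Definition _ := [isSub for @bop_fun R V].
HB.instance Definition _ := [Choice of bop V by <:].
HB.instance Definition _ := GRing.SubChoice_isSubLmodule.Build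
  C (V -> V) (@bounded_linear R V) (bop V) bounded_linear_closed.

Implicit Types S T : B.

Lemma bop_eq S T : S =1 T -> S = T.
Proof. by move=> ST; apply/val_inj/funext. Qed.

Lemma bop_linear T : linear T.
Proof. by have /asboolP[] := bopP T. Qed.

HB.instance Definition _ T := GRing.isLinear.Build C V V *:%R T (bop_linear T).

Lemma bop_bounded T : exists M : R, forall v, rnorm (T v) <= M * rnorm v.
Proof. by have /asboolP[] := bopP T. Qed.

Lemma bop_id_subproof : (@id V) \in @bounded_linear R V.
Proof. by apply/asboolP; split=> //; exists 1 => v; rewrite mul1r. Qed.

Lemma bop_comp_subproof S T : (S \o T) \in @bounded_linear R V.
Proof.
apply/asboolP; split=> [a u v|]; first by rewrite /= !linearP.
have [[M SM] [N TN]] := (bop_bounded S, bop_bounded T).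
exists (`|M| * N) => v; apply: le_trans (SM _) _ => /=; rewrite -mulrA.
apply: (@le_trans _ _ (`|M| * rnorm (T v))).
  by rewrite ler_wpM2r ?rnorm_ge0 ?ler_norm.
by rewrite ler_wpM2l.
Qed.

Definition bop_id : B := Bop bop_id_subproof.
Definition bop_comp S T : B := Bop (bop_comp_subproof S T).

Let bop_compA : associative bop_comp.
Proof. by move=> S T U; apply: bop_eq. Qed.
Let bop_comp1r : left_id bop_id bop_comp.
Proof. by move=> S; apply: bop_eq. Qed.
Let bop_compr1 : right_id bop_id bop_comp.
Proof. by move=> S; apply: bop_eq. Qed.
Let bop_compDl : left_distributive bop_comp +%R.
Proof. by move=> S T U; apply: bop_eq. Qed.
Let bop_compDr : right_distributive bop_comp +%R.
Proof. by move=> S T U; apply: bop_eq => v /=; rewrite [LHS]linearD. Qed.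

HB.instance Definition _ := GRing.Zmodule_isPzRing.Build (bop V)
  bop_compA bop_comp1r bop_compr1 bop_compDl bop_compDr.

Lemma bop_mulE S T v : (S * T) v = S (T v). Proof. by []. Qed.

Lemma bop_oneE v : (1 : B) v = v. Proof. by []. Qed.

Lemma bop_addE S T v : (S + T) v = S v + T v. Proof. by []. Qed.

Lemma bop_scaleE c T v : (c *: T) v = c *: T v. Proof. by []. Qed.

Lemma bop_zeroE v : (0 : B) v = 0. Proof. by []. Qed.

Definition opnorm T : R := sup [set rnorm (T v) | v in [set v | rnorm v <= 1]].

Let unit_image T : set R := [set rnorm (T v) | v in [set v | rnorm v <= 1]].

Let rnorm0_le1 : rnorm (0 : V) <= 1.
Proof. by rewrite rnorm0 ler01. Qed.

Let unit_image_neq0 T : (unit_image T) !=set0.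
Proof. by exists (rnorm (T 0)), 0 => //; exact: rnorm0_le1. Qed.

Let unit_image_ub T : has_ubound (unit_image T).
Proof.
have [M TM] := bop_bounded T; exists `|M| => _ [v /= v1 <-].
apply: le_trans (TM v) _; apply: (@le_trans _ _ (`|M| * rnorm v)).
  by rewrite ler_wpM2r ?rnorm_ge0 ?ler_norm.
by rewrite ler_piMr.
Qed.

Lemma opnorm_ge0 T : 0 <= opnorm T.
Proof.
apply: (@le_trans _ _ (rnorm (T 0))); first exact: rnorm_ge0.
by apply: (ub_le_sup (unit_image_ub T)); exists 0 => //; exact: rnorm0_le1.
Qed.

Lemma le_opnorm T v : rnorm (T v) <= opnorm T * rnorm v.
Proof.
have [->|v0] := eqVneq v 0; first by rewrite linear0 rnorm0 mulr0.
have nv0 : 0 < rnorm v.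
  by rewrite lt0r rnorm_ge0 andbT; apply: contra_neq v0; exact: rnorm0_eq0.
have rV : rnorm ((rnorm v)^-1)%:C = (rnorm v)^-1.
  apply: complexI; rewrite -rnormE ger0_norm// lecR invr_ge0 ltW//.
rewrite -ler_pdivrMr// mulrC -rV -rnormZ -linearZ.
apply: (ub_le_sup (unit_image_ub T)); exists (((rnorm v)^-1)%:C *: v) => //=.
by rewrite rnormZ rV mulVf// gt_eqF.
Qed.

Lemma opnorm_le T M : 0 <= M -> (forall v, rnorm (T v) <= M * rnorm v) ->
  opnorm T <= M.
Proof.
move=> M0 TM; apply: (ge_sup (unit_image_neq0 T)) => _ [v /= v1 <-].
by apply: le_trans (TM v) _; rewrite ler_piMr.
Qed.

Lemma opnormD S T : opnorm (S + T) <= opnorm S + opnorm T.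
Proof.
apply: opnorm_le => [|v]; first by rewrite addr_ge0 ?opnorm_ge0.
by apply: le_trans (ler_rnormD _ _) _; rewrite mulrDl lerD ?le_opnorm.
Qed.

Lemma opnormM S T : opnorm (S * T) <= opnorm S * opnorm T.
Proof.
apply: opnorm_le => [|v]; first by rewrite mulr_ge0 ?opnorm_ge0.
rewrite bop_mulE; apply: le_trans (le_opnorm S _) _.
by rewrite -mulrA ler_wpM2l ?opnorm_ge0 ?le_opnorm.
Qed.

Let opnormZ_le c T : opnorm (c *: T) <= rnorm c * opnorm T.
Proof.
apply: opnorm_le => [|v]; first by rewrite mulr_ge0 ?rnorm_ge0 ?opnorm_ge0.
by rewrite bop_scaleE rnormZ -mulrA ler_wpM2l ?rnorm_ge0 ?le_opnorm.
Qed.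

Lemma opnormZ c T : opnorm (c *: T) = rnorm c * opnorm T.
Proof.
apply/eqP; rewrite eq_le opnormZ_le/=.
have [->|c0] := eqVneq c 0; first by rewrite rnorm0 mul0r opnorm_ge0.
rewrite -{1}(scalerK c0 T).
apply: le_trans (ler_wpM2l (rnorm_ge0 _) (opnormZ_le _ _)) _.
rewrite mulrA -rnormM divff// (_ : rnorm 1 = 1) ?mul1r//.
by rewrite /rnorm normr1.
Qed.

Lemma opnorm0_eq0 T : opnorm T = 0 -> T = 0.
Proof.
move=> T0; apply: bop_eq => v; apply: rnorm0_eq0; apply/eqP.
by rewrite eq_le rnorm_ge0 andbT -(mul0r (rnorm v)) -T0 le_opnorm.
Qed.

Let normB T : C := (opnorm T)%:C.

Let ler_normBD S T : normB (S + T) <= normB S + normB T.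
Proof. by rewrite /normB -rmorphD/= lecR opnormD. Qed.

Let normBZ c T : normB (c *: T) = `|c| * normB T.
Proof. by rewrite /normB opnormZ rmorphM/= -rnormE. Qed.

Let normB0_eq0 T : normB T = 0 -> T = 0.
Proof. by move=> /complexI/opnorm0_eq0. Qed.

HB.instance Definition _ := Lmodule_isNormed.Build C (bop V)
  ler_normBD normBZ normB0_eq0.

Lemma rnorm_bop T : rnorm T = opnorm T. Proof. by []. Qed.

Definition subalgebra (X : set B) : Prop :=
  [/\ X 0, forall S T, X S -> X T -> X (S + T),
      forall c T, X T -> X (c *: T) & forall S T, X S -> X T -> X (S * T)].

Definition closed_algebra (G : set B) : set B := closure (smallest subalgebra G).

Lemma closed_algebraP (G : set B) T : closed_algebra G T <->
  forall e : R, 0 < e -> exists2 S, smallest subalgebra G S & opnorm (T - S) < e.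
Proof.
split=> [GT e e0|GT A /nbhs_normP[e /= e0 eA]].
  have e0C : 0 < e%:C by rewrite ltcR.
  have [S [GS TS]] := GT _ (nbhsx_ballx T _ e0C).
  by exists S => //; move: TS; rewrite -ball_normE /= rnormE ltcR.
have eE : e = (complex.Re e)%:C by rewrite RRe_real// gtr0_real.
have [|S GS TS] := GT (complex.Re e); first by rewrite -ltcR -eE.
by exists S; split=> //; apply: eA; rewrite /= rnormE eE ltcR.
Qed.

(* A derivation of the algebra A is a map A -> A; here it is given by a total
   function of which only the values on A matter. *)
Definition derivation_on (A : set B) (delta : B -> B) : Prop :=
  [/\ forall S, A S -> A (delta S),
      forall c S T, A S -> A T -> delta (c *: S + T) = c *: delta S + delta T &
      forall S T, A S -> A T -> delta (S * T) = delta S * T + S * delta T].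

Definition inner_derivation T : B -> B := fun S => S * T - T * S.

End bop_algebra.

(* The operator f |-> (j |-> f i if t i = Some j, and 0 if j is not a value of
   t): it maps the i-th basis vector to the (t i)-th one, or to 0 when t i is
   undefined; see shift_opE. *)
Section shift.
Variables (R : realType) (I : choiceType) (t : I -> option I).
Local Notation C := R[i].

Definition partial_injective :=
  forall i j k, t i = Some k -> t j = Some k -> i = j.

Definition shift_preim (j : I) : option I :=
  if pselect (exists i, t i = Some j) is left h then Some (projT1 (cid h))
  else None.

Lemma shift_preimP j : if shift_preim j is Some i then t i = Some j
  else forall i, t i <> Some j.
Proof.
rewrite /shift_preim; case: pselect => [h|h i ti]; first by case: cid.
by apply: h; exists i.
Qed.

Definition shift_fun (f : I -> C) (j : I) : C :=
  if shift_preim j is Some i then f i else 0.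

Lemma shift_fun_le (u : l2 R I) (s : seq I) : uniq s ->
  \sum_(j <- s) rnorm (shift_fun u j) ^+ 2 <= l2norm u ^+ 2.
Proof.
move=> us; pose g i := odflt i (t i).
have gK : ocancel shift_preim g.
  by move=> j; have := shift_preimP j; rewrite /g; case: shift_preim => //= i ->.
rewrite [leLHS](_ : _ = \sum_(i <- pmap shift_preim s) rnorm (u i) ^+ 2).
  by rewrite sum_le_l2norm// (pmap_uniq gK).
elim: s {us} => [|j s IH]; first by rewrite !big_nil.
rewrite big_cons IH /= /shift_fun; case: shift_preim => [i|] /=.
  by rewrite big_cons.
by rewrite rnorm0 expr0n add0r.
Qed.

Lemma shift_l2_subproof (u : l2 R I) : shift_fun u \in @square_summable R I.
Proof.
apply/square_summableP; exists (l2norm u ^+ 2) => s; exact: shift_fun_le.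
Qed.

Definition shift_l2 (u : l2 R I) : l2 R I := L2 (shift_l2_subproof u).

Lemma shift_bop_subproof : shift_l2 \in @bounded_linear R (l2 R I).
Proof.
apply/asboolP; split=> [a u v|].
  apply: l2_eq => j; rewrite l2_addE l2_scaleE /= /shift_fun.
  by case: shift_preim => [i|]; rewrite ?l2_addE ?l2_scaleE// mulr0 addr0.
exists 1 => u; rewrite mul1r !rnorm_l2; apply/l2norm_leP => [|s].
  exact: l2norm_ge0.
exact: shift_fun_le.
Qed.

Definition shift_op : bop (l2 R I) := Bop shift_bop_subproof.

End shift.

Section l2_basis.
Variables (R : realType) (I : choiceType).

Lemma l2_delta_subproof (i : I) :
  (fun j => (j == i)%:R : R[i]) \in @square_summable R I.
Proof.
apply/square_summableP; exists 1 => s us.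
have [si|si] := boolP (i \in s).
  rewrite (bigD1_seq i)//= eqxx big1 => [|j /negPf->].
    by rewrite /rnorm normr1 expr1n addr0.
  by rewrite rnorm0 expr0n.
rewrite big1_seq// => j /andP[_ sj].
have /negPf-> : j != i by apply: contraNneq si => <-.
by rewrite rnorm0 expr0n.
Qed.

Definition l2_delta (i : I) : l2 R I := L2 (l2_delta_subproof i).

Lemma shift_opE (t : I -> option I) (i : I) : partial_injective t ->
  shift_op R t (l2_delta i) = if t i is Some j then l2_delta j else 0.
Proof.
move=> tinj; apply: l2_eq => j; rewrite /= /shift_fun.
have := shift_preimP t j; case: shift_preim => [k tk|tj].
  case ti: (t i) => [l|] /=; last by case: eqP ti => // <-; rewrite tk.
  congr (_%:R); congr nat_of_bool; apply/eqP/eqP => [ki|jl].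
    by move: tk; rewrite ki ti => -[->].
  by apply: tinj tk _; rewrite jl.
case ti: (t i) => [l|] //=; case: eqP => // jl.
by have := tj i; rewrite ti jl.
Qed.

End l2_basis.

Record digraph := Digraph {
  vertex : choiceType;
  edge : choiceType;
  rng : edge -> vertex;
  src : edge -> vertex }.

Fixpoint is_path (G : digraph) (x : vertex G) (p : seq (edge G)) : bool :=
  if p is f :: q then (rng f == x) && is_path (src f) q else true.

(* The pair (x, [:: f1; ...; fk]) encodes the path f1...fk with range x; for
   k = 0 it is the vertex x. *)
Record dpath (G : digraph) := DPath {
  dpath_val : vertex G * seq (edge G);
  dpathP : is_path dpath_val.1 dpath_val.2 }.

HB.instance Definition _ (G : digraph) := [isSub for @dpath_val G].
HB.instance Definition _ (G : digraph) := [Choice of dpath G by <:].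

Section paths.
Variable G : digraph.
Implicit Types (x : vertex G) (e : edge G) (w : dpath G).

Definition path_rng w : vertex G := (dpath_val w).1.
Definition path_edges w : seq (edge G) := (dpath_val w).2.

Lemma edge_mul_subproof e w : path_rng w = src e ->
  is_path (rng e) (e :: path_edges w).
Proof. by move=> /= <-; rewrite eqxx dpathP. Qed.

(* The product ew, when defined. *)
Definition edge_mul e w : option (dpath G) :=
  if eqVneq (path_rng w) (src e) is EqNotNeq h
  then Some (@DPath G (rng e, e :: path_edges w) (edge_mul_subproof h))
  else None.

(* The product xw, when defined. *)
Definition vertex_mul x w : option (dpath G) :=
  if path_rng w == x then Some w else None.

Lemma edge_mul_inj e : partial_injective (edge_mul e).
Proof.
move=> w1 w2 w; rewrite /edge_mul.
case: eqVneq => // h1 [E1]; case: eqVneq => // h2 [E2].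
have [] := congr1 path_edges (etrans E1 (esym E2)); rewrite /path_edges => w12.
apply/val_inj; rewrite /= (surjective_pairing (dpath_val w1)).
by rewrite (surjective_pairing (dpath_val w2)) w12; congr pair; rewrite [LHS]h1.
Qed.

Lemma vertex_mul_inj x : partial_injective (vertex_mul x).
Proof.
by move=> w1 w2 w; rewrite /vertex_mul; do 2 case: ifP => // _ [->].
Qed.

End paths.

Section graph_algebra.
Variables (R : realType) (G : digraph).
Local Notation H := (l2 R (dpath G)).
Implicit Types (x : vertex G) (e : edge G) (w : dpath G).

Definition L_edge e : bop H := shift_op R (edge_mul e).
Definition L_vertex x : bop H := shift_op R (vertex_mul x).

Lemma L_edgeE e w :
  L_edge e (l2_delta R w) = if edge_mul e w is Some ew then l2_delta R ew else 0.
Proof. by apply: shift_opE; exact: edge_mul_inj. Qed.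

Lemma L_vertexE x w :
  L_vertex x (l2_delta R w) = if path_rng w == x then l2_delta R w else 0.
Proof.
by rewrite shift_opE ?/vertex_mul; [case: eqP|exact: vertex_mul_inj].
Qed.

Definition graph_algebra : set (bop H) :=
  closed_algebra (range L_edge `|` range L_vertex).

End graph_algebra.

Arguments graph_algebra R G _ : clear implicits.

(* The vertex v_(j+1) and the edge e_(j+1) are both represented by j : 'I_n. *)
Definition circle_graph (n : nat) : digraph :=
  @Digraph 'I_n 'I_n (fun j => j) (fun j => ordS j).

(* Main.v *)
Require Import Defs.
From HB Require Import structures.
From mathcomp Require Import all_boot all_order all_algebra.
From mathcomp Require Import all_classical all_reals ereal topology normedtype.
From mathcomp Require Import sequences esum complex.
From mathcomp Require Import lra zify.

Set Implicit Arguments.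
Unset Strict Implicit.
Unset Printing Implicit Defensive.

Import Order.TTheory GRing.Theory Num.Theory.

Local Open Scope classical_set_scope.
Local Open Scope ring_scope.
Local Open Scope complex_scope.

(** Let [U] be the sum of the edge operators, [P j] the vertex projections and
    [A] the algebra.  Adding the unique edge on the left is an injection of the
    set of paths, so [U] is an isometry with left inverse [V], and
    [P j * U = U * P (ordS j)].  As going [n] steps round the circle leads back
    to the same vertex, [Z = U ^+ n] is central in [A].

    Everything rests on an exact expansion, to which a possibly unbounded
    derivation can be applied: each [S] in [A] is [D + U * S'] with [D] diagonal
    and [S'] again in [A] ([graph_algebra_expansion]).  This holds for
    polynomials in the generators, and passes to norm limits because [D] and
    [S'] depend boundedly on [S].  Iterating it gives operator Taylor
    coefficients, and an operator divisible by all powers of [U] is zero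
    ([shiftX_divisible_eq0]).

    A derivation [delta] vanishes at [Z] ([derivation_cycle0]).  Indeed
    [h = delta Z] is central, so [delta (Z ^+ k) = k Z^(k-1) h], and on a power
    series [F] in [Z] the derivation is [h] times the formal derivative of [F].
    If [h] had a first nonzero coefficient, a lacunary series [F] in [A], of
    which the derivative has rapidly growing coefficients, would give an element
    [delta F] of [A] with unbounded coefficients.

    The rest is a pair of averages.  Subtracting the inner derivation of
    [\sum_i P i * delta (P i)], one may assume that [delta] kills the
    projections ([derivation_vertex_inner]).  Then [delta (U ^+ k)] is
    divisible by [U ^+ k] for [k <= n], with quotient [tau k], and since
    [delta Z = 0] the mean of [tau k] over [k < n] is an element whose inner
    derivation agrees with [delta] at [U] and at the projections
    ([derivation_shift_inner]).  The difference kills all generators, hence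
    [delta (D + U * S') = U * delta S'], and all its values are divisible by all
    powers of [U], so it is zero ([derivation_eq0]). *)

(** * Bounded operators and closed algebras of operators *)

Section bounded_operators.
Variables (R : realType) (V : normedModType R[i]).
Implicit Types (S T : bop V) (G X : set (bop V)) (phi : bop V -> bop V).

Lemma bop_scalerAl (c : R[i]) S T : (c *: S) * T = c *: (S * T).
Proof. exact: bop_eq. Qed.

Lemma bop_scalerAr (c : R[i]) S T : S * (c *: T) = c *: (S * T).
Proof. by apply: bop_eq => v; rewrite bop_mulE !bop_scaleE linearZ. Qed.

Lemma opnormB S T : opnorm (S - T) <= opnorm S + opnorm T.
Proof.
have <- : opnorm (- T) = opnorm T by rewrite -!rnorm_bop /rnorm normrN.
exact: opnormD.
Qed.

Lemma opnormX_le1 T k : opnorm T <= 1 -> opnorm (T ^+ k) <= 1.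
Proof.
move=> T1; elim: k => [|k IH].
  by rewrite expr0; apply: opnorm_le => // v; rewrite mul1r.
rewrite exprS; apply: le_trans (opnormM _ _) _.
by rewrite -[leRHS]mulr1 ler_pM ?opnorm_ge0.
Qed.

Lemma opnormZX (c : R[i]) T k : opnorm T <= 1 ->
  opnorm (c *: T ^+ k) <= rnorm c.
Proof.
by move=> T1; rewrite opnormZ ler_piMr ?rnorm_ge0// opnormX_le1.
Qed.

Lemma smallest_subalgebra G : subalgebra (smallest (@subalgebra R V) G).
Proof.
split=> [X [[]]//|S T GS GT X GX|c T GT X GX|S T GS GT X GX].
- by have [[_ XD _ _] _] := GX; apply: XD; [exact: GS|exact: GT].
- by have [[_ _ XZ _] _] := GX; apply: XZ; exact: GT.
- by have [[_ _ _ XM] _] := GX; apply: XM; [exact: GS|exact: GT].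
Qed.

Lemma sub_closed_algebra G :
  smallest (@subalgebra R V) G `<=` closed_algebra G.
Proof. exact: subset_closure. Qed.

(** By density; the case of a multiplication by a fixed operator is what makes
    the norm closure an algebra. *)
Lemma bounded_additive_closed_algebra G phi (K : R) :
  (forall S T, phi (S - T) = phi S - phi T) ->
  (forall T, opnorm (phi T) <= K * opnorm T) ->
  (forall S, smallest (@subalgebra R V) G S -> closed_algebra G (phi S)) ->
  forall S, closed_algebra G S -> closed_algebra G (phi S).
Proof.
move=> phiB phiK phiG S /closed_algebraP GS; apply/closed_algebraP => e e0.
have K0 : 0 < `|K| + 1 by rewrite ltr_pwDr.
have [|S0 GS0 SS0] := GS (e / 2 / (`|K| + 1)); first by rewrite !divr_gt0.
have /closed_algebraP/(_ (e / 2)) := phiG _ GS0.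
case=> [|T0 GT0 ST0]; first by rewrite divr_gt0.
exists T0 => //.
rewrite (_ : _ - _ = (phi S - phi S0) + (phi S0 - T0)); last first.
  by rewrite addrA subrK.
apply: le_lt_trans (opnormD _ _) _; rewrite [ltRHS]splitr ler_ltD// -phiB.
apply: le_trans (phiK _) _.
have Kle : K <= `|K| + 1 by rewrite (le_trans (ler_norm K))// lerDl.
apply: le_trans (ler_wpM2r (opnorm_ge0 _) Kle) _.
by rewrite mulrC -ler_pdivlMr// ltW.
Qed.

Lemma bounded_additive_closed_algebra0 G phi (K : R) :
  (forall S T, phi (S - T) = phi S - phi T) ->
  (forall T, opnorm (phi T) <= K * opnorm T) ->
  (forall S, smallest (@subalgebra R V) G S -> phi S = 0) ->
  forall S, closed_algebra G S -> phi S = 0.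
Proof.
move=> phiB phiK phiG S /closed_algebraP GS; apply: opnorm0_eq0.
apply/eqP; rewrite eq_le opnorm_ge0 andbT; apply/ler_addgt0Pr => e e0.
rewrite add0r; have K0 : 0 < `|K| + 1 by rewrite ltr_pwDr.
have [|S0 GS0 SS0] := GS (e / (`|K| + 1)); first by rewrite divr_gt0.
rewrite -[phi S]subr0 -(phiG _ GS0) -phiB.
apply: le_trans (phiK _) _.
have Kle : K <= `|K| + 1 by rewrite (le_trans (ler_norm K))// lerDl.
apply: le_trans (ler_wpM2r (opnorm_ge0 _) Kle) _.
by rewrite mulrC -ler_pdivlMr// ltW.
Qed.

Lemma closed_algebraM G S T :
  closed_algebra G S -> closed_algebra G T -> closed_algebra G (S * T).
Proof.
have [_ _ _ GM] := smallest_subalgebra G => GS GT.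
apply: (@bounded_additive_closed_algebra G (fun S => S * T) (opnorm T)) GS
  => [S1 S2|S1|S1 GS1]; first exact: mulrBl.
  by rewrite mulrC opnormM.
apply: (@bounded_additive_closed_algebra G (fun T => S1 * T) (opnorm S1)) GT
  => [T1 T2|T1|T1 GT1]; first exact: mulrBr.
  exact: opnormM.
by apply: sub_closed_algebra; exact: GM.
Qed.

Lemma closed_algebraZ G c T : closed_algebra G T -> closed_algebra G (c *: T).
Proof.
have [_ _ GZ _] := smallest_subalgebra G.
apply: (@bounded_additive_closed_algebra G _ (rnorm c))
  => [T1 T2|T1|T1 GT1]; first exact: scalerBr.
  by rewrite opnormZ.
by apply: sub_closed_algebra; exact: GZ.
Qed.

Lemma closed_algebraD G S T :
  closed_algebra G S -> closed_algebra G T -> closed_algebra G (S + T).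
Proof.
have [_ GD _ _] := smallest_subalgebra G.
move=> /closed_algebraP GS /closed_algebraP GT; apply/closed_algebraP => e e0.
have e20 : 0 < e / 2 by rewrite divr_gt0.
have [[S0 GS0 SS0] [T0 GT0 TT0]] := (GS _ e20, GT _ e20).
exists (S0 + T0); first exact: GD.
rewrite opprD addrACA; apply: le_lt_trans (opnormD _ _) _.
by rewrite [ltRHS]splitr ltrD.
Qed.

Lemma closed_algebra0 G : closed_algebra G 0.
Proof. by apply: sub_closed_algebra; have [] := smallest_subalgebra G. Qed.

Lemma closed_algebraB G S T :
  closed_algebra G S -> closed_algebra G T -> closed_algebra G (S - T).
Proof.
move=> GS GT; rewrite -scaleN1r.
by apply: closed_algebraD => //; exact: closed_algebraZ.
Qed.

Lemma closed_algebra_sum G (J : Type) (s : seq J) (F : J -> bop V) :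
  (forall j, closed_algebra G (F j)) -> closed_algebra G (\sum_(j <- s) F j).
Proof.
move=> GF; elim/big_ind: _ => //; first exact: closed_algebra0.
exact: closed_algebraD.
Qed.

End bounded_operators.

Lemma bop_l2B (R : realType) (I : choiceType) (S T : bop (l2 R I)) u w :
  (S - T) u w = S u w - T u w.
Proof. by []. Qed.

(** Coordinates of an l2 vector are finitely checkable, so a sequence of
    operators of which every coordinate is eventually constant has a limit, and
    any bound on its increments passes to the limit.  This provides the norm
    convergent series below without completeness of the operator space. *)
Lemma stabilizing_limit (R : realType) (I : choiceType)
    (T : nat -> bop (l2 R I)) (l : I -> nat) (eps : nat -> R) :
  (forall w K u, (l w <= K)%N -> T K u w = T (l w) u w) ->
  (forall K K', (K <= K')%N -> opnorm (T K' - T K) <= eps K) ->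
  exists F : bop (l2 R I), forall K, opnorm (F - T K) <= eps K.
Proof.
move=> Tl Teps.
pose f (u : l2 R I) w := T (l w) u w.
have f_fin u (s : seq I) : exists K0,
    forall K, (K0 <= K)%N -> forall w, w \in s -> f u w = T K u w.
  elim: s => [|w s [K0 IH]]; first by exists 0%N.
  exists (maxn (l w) K0) => // K; rewrite geq_max => /andP[wK K0K] x.
  by rewrite inE => /predU1P[->|/(IH _ K0K)//]; rewrite Tl.
have eps0 K : 0 <= eps K by exact: le_trans (opnorm_ge0 _) (Teps K K (leqnn K)).
have f_le u K (s : seq I) : uniq s ->
    \sum_(w <- s) rnorm (f u w - T K u w) ^+ 2 <= (eps K * l2norm u) ^+ 2.
  move=> us; have [K0 fK0] := f_fin u s.
  have KK : (K <= maxn K K0)%N by rewrite leq_maxl.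
  rewrite big_seq (eq_bigr (fun w => rnorm ((T (maxn K K0) - T K) u w) ^+ 2)).
    rewrite -big_seq; apply: le_trans (sum_le_l2norm _ us) _.
    rewrite ler_sqr ?nnegrE ?mulr_ge0 ?l2norm_ge0//.
    rewrite -!rnorm_l2; apply: le_trans (le_opnorm _ _) _.
    by rewrite ler_wpM2r ?rnorm_ge0// Teps.
  by move=> w ws; rewrite bop_l2B (fK0 (maxn K K0) (leq_maxr _ _) w ws).
have g_l2 u : (fun w => f u w - T 0%N u w) \in @square_summable R I.
  by apply/square_summableP; exists ((eps 0%N * l2norm u) ^+ 2) => s /f_le.
have f_l2 u : f u \in @square_summable R I.
  suff -> : f u = l2_fun (L2 (g_l2 u) + T 0%N u) by exact: l2P.
  by apply/funext => w; rewrite l2_addE /= subrK.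
pose F u := L2 (f_l2 u).
have F_le K u : l2norm (F u - T K u) <= eps K * l2norm u.
  by apply/l2norm_leP => [|s us]; [rewrite mulr_ge0 ?l2norm_ge0|exact: f_le].
have F_bop : F \in @bounded_linear R (l2 R I).
  apply/asboolP; split=> [a u v|].
    apply: l2_eq => w.
    by rewrite l2_addE l2_scaleE /= /f linearP l2_addE l2_scaleE.
  exists (eps 0%N + opnorm (T 0%N)) => u; rewrite !rnorm_l2.
  rewrite -[F u](subrK (T 0%N u)); apply: le_trans (l2normD _ _) _.
  have Tu : l2norm (T 0%N u) <= opnorm (T 0%N) * l2norm u.
    by have := le_opnorm (T 0%N) u; rewrite !rnorm_l2.
  by rewrite mulrDl lerD.
exists (Bop F_bop) => K; apply: opnorm_le => // u; rewrite !rnorm_l2.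
by have -> : (Bop F_bop - T K) u = F u - T K u by [].
Qed.

Lemma opnorm_shift (R : realType) (I : choiceType) (t : I -> option I) :
  opnorm (shift_op R t) <= 1.
Proof.
apply: opnorm_le => // u; rewrite mul1r !rnorm_l2.
by apply/l2norm_leP => [|s]; [exact: l2norm_ge0|exact: shift_fun_le].
Qed.

Lemma shift_preimK (I : choiceType) (t : I -> option I) i j :
  partial_injective t -> t i = Some j -> shift_preim t j = Some i.
Proof.
move=> t_inj tij; have := shift_preimP t j.
by case: shift_preim => [k tkj|/(_ i)//]; rewrite (t_inj _ _ _ tkj tij).
Qed.

Lemma shift_op_coord (R : realType) (I : choiceType) (t : I -> option I)
    (u : l2 R I) i j : partial_injective t -> t i = Some j ->
  shift_op R t u j = u i.
Proof. by move=> t_inj tij; rewrite /= /shift_fun (shift_preimK t_inj tij). Qed.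

Lemma shift_op_coord0 (R : realType) (I : choiceType) (t : I -> option I)
    (u : l2 R I) j : (forall i, t i <> Some j) -> shift_op R t u j = 0.
Proof.
rewrite /= /shift_fun => tj; have := shift_preimP t j.
by case: shift_preim => // i /tj.
Qed.

Lemma bop_sumE (R : realType) (I : choiceType) (J : Type) (s : seq J)
    (F : J -> bop (l2 R I)) u w :
  (\sum_(j <- s) F j) u w = \sum_(j <- s) F j u w.
Proof. by elim/big_rec2: _ => // j y T _ <-. Qed.

(** * The shift of the circle graph *)

Section circle.
Variables (R : realType) (n : nat).
Local Notation C := R[i].
Local Notation G := (circle_graph n).
Local Notation H := (l2 R (dpath G)).
Implicit Types (u : H) (w : dpath G) (S T : bop H) (d : 'I_n -> C).

Definition path_length w : nat := size (path_edges w).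

Definition vertex_path (j : 'I_n) : dpath G := @DPath G (j, [::]) isT.

Lemma prepend_subproof w : path_rng w = src (ord_pred (path_rng w) : edge G).
Proof. by rewrite /= ord_predK. Qed.

(** Exactly one edge has its source at the range of a given path, so every path
    has one and only one extension to the left. *)
Definition prepend w : dpath G :=
  @DPath G
    (ord_pred (path_rng w), (ord_pred (path_rng w) : 'I_n) :: path_edges w)
    (edge_mul_subproof (prepend_subproof w)).

Lemma path_rng_prepend w : path_rng (prepend w) = ord_pred (path_rng w).
Proof. by []. Qed.

Lemma edge_mul_prepend (e : 'I_n) w :
  @edge_mul G e w = if path_rng w == ordS e then Some (prepend w) else None.
Proof.
rewrite /edge_mul; case: eqVneq => [h|//]; congr Some.
apply/val_inj; rewrite /= /path_rng /path_edges /=.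
by move: h; rewrite /path_rng /= => ->; rewrite ordSK.
Qed.

Lemma prepend_inj : partial_injective (Some \o prepend).
Proof.
move=> w1 w2 w /= <- /(congr1 (odflt w1)) /= w21; apply/val_inj => /=.
have e1 : path_rng w1 = path_rng w2.
  exact: (can_inj (@ord_predK n)) (esym (congr1 (@path_rng G) w21)).
have e2 := congr1 (behead \o @path_edges G) w21.
rewrite (surjective_pairing (dpath_val w1)) (surjective_pairing (dpath_val w2)).
by congr pair; [exact: e1|exact: esym e2].
Qed.

(** On l2 of the paths, the shift is the sum of all the edge operators, and the
    backward shift is its adjoint. *)
Definition circle_shift : bop H := shift_op R (Some \o prepend).
Definition circle_unshift : bop H :=
  shift_op R (shift_preim (Some \o prepend)).
Local Notation U := circle_shift.
Local Notation V := circle_unshift.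
Local Notation P := (@L_vertex R G).
Local Notation A := (graph_algebra R G).

Lemma shift_prepend u w : U u (prepend w) = u w.
Proof. by apply: shift_op_coord => //; exact: prepend_inj. Qed.

Lemma unshift_coord u w : V u w = u (prepend w).
Proof.
apply: shift_op_coord => [w1 w2 w0|]; last exact: shift_preimK prepend_inj _.
have := shift_preimP (Some \o prepend) w1.
case: shift_preim => // x wx [<-].
have := shift_preimP (Some \o prepend) w2.
by case: shift_preim => // y wy [xy]; move: wy; rewrite xy wx => -[].
Qed.

Lemma prependP w : (exists w', w = prepend w') \/ (forall u, U u w = 0).
Proof.
have [[w' ->]|nw] := pselect (exists w', w = prepend w').
  by left; exists w'.
right=> u; apply: shift_op_coord0 => w' [ww']; apply: nw.
by exists w'; rewrite ww'.
Qed.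

Lemma shiftX_coord0 k u w : (path_length w < k)%N -> (U ^+ k) u w = 0.
Proof.
elim: k w => // k IH w wk; rewrite exprS bop_mulE.
have [[w' w'E]|//] := prependP w.
by rewrite w'E shift_prepend IH//; move: wk; rewrite w'E.
Qed.

Lemma shiftX_vertex k u j : (0 < k)%N -> (U ^+ k) u (vertex_path j) = 0.
Proof. by move=> k0; rewrite shiftX_coord0. Qed.

(** A coordinate at a path of length [l] vanishes on the range of every power
    of the shift beyond the [l]-th.  This takes the place of the uniqueness of
    power series expansions. *)
Lemma shiftX_divisible_eq0 S : (forall k, exists T, S = U ^+ k * T) -> S = 0.
Proof.
move=> SU; apply: bop_eq => u; apply: l2_eq => w.
have [T ->] := SU (path_length w).+1.
by rewrite bop_mulE shiftX_coord0.
Qed.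

Lemma unshiftK : V * U = 1.
Proof.
by apply: bop_eq => u; apply: l2_eq => w; rewrite unshift_coord shift_prepend.
Qed.

Lemma unshiftXK k : V ^+ k * U ^+ k = 1.
Proof.
elim: k => [|k IH]; first by rewrite mulr1.
by rewrite exprSr exprS mulrA -[_ * V * U]mulrA unshiftK mulr1.
Qed.

Lemma shiftX_inj k : injective ( *%R (U ^+ k)).
Proof.
by apply: (can_inj (g := *%R (V ^+ k))) => S; rewrite mulrA unshiftXK mul1r.
Qed.

Lemma opnorm_circle_shift : opnorm U <= 1. Proof. exact: opnorm_shift. Qed.
Lemma opnorm_circle_unshift : opnorm V <= 1. Proof. exact: opnorm_shift. Qed.

(** * Diagonal operators and the expansion along the shift *)

Lemma L_vertex_coord (j : 'I_n) u w :
  P j u w = (path_rng w == j)%:R * u w.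
Proof.
have [wj|wj] := eqVneq.
  rewrite mul1r; apply: shift_op_coord; first exact: vertex_mul_inj.
  by rewrite /vertex_mul wj eqxx.
rewrite mul0r; apply: shift_op_coord0 => w'.
by rewrite /vertex_mul; case: eqP => // w'j [ww']; rewrite -ww' w'j eqxx in wj.
Qed.

Definition diag_op d : bop H := \sum_j d j *: P j.

Lemma diag_opE d u w : diag_op d u w = d (path_rng w) * u w.
Proof.
have E j : (d j *: P j) u w = d j * ((path_rng w == j)%:R * u w).
  by rewrite bop_scaleE l2_scaleE L_vertex_coord.
rewrite bop_sumE (eq_bigr _ (fun j _ => E j)) (bigD1 (path_rng w : 'I_n))//=.
rewrite eqxx mul1r big1 ?addr0// => j jw.
by rewrite [_ == j]eq_sym (negPf jw) mul0r mulr0.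
Qed.

Lemma L_vertex_diag (j : 'I_n) : P j = diag_op (fun i => (i == j)%:R).
Proof.
by apply: bop_eq => u; apply: l2_eq => w; rewrite diag_opE L_vertex_coord.
Qed.

Lemma diag_op_sum d e : diag_op (fun i => d i + e i) = diag_op d + diag_op e.
Proof. by rewrite -big_split; apply: eq_bigr => j _; rewrite scalerDl. Qed.

Lemma diag_op_scale c d : diag_op (fun i => c * d i) = c *: diag_op d.
Proof. by rewrite scaler_sumr; apply: eq_bigr => j _; rewrite scalerA. Qed.

Lemma diag_op_mul d e : diag_op (fun i => d i * e i) = diag_op d * diag_op e.
Proof.
by apply: bop_eq => u; apply: l2_eq => w; rewrite bop_mulE !diag_opE mulrA.
Qed.

Lemma diag_op0 : diag_op (fun=> 0) = 0.
Proof. by rewrite /diag_op big1// => j _; rewrite scale0r. Qed.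

Lemma diag_op_shift d :
  diag_op d * U = U * diag_op (fun i => d (ord_pred i)).
Proof.
apply: bop_eq => u; apply: l2_eq => w; rewrite !bop_mulE diag_opE.
have [[w' ->]|U0] := prependP w; last by rewrite !U0 mulr0.
by rewrite !shift_prepend diag_opE path_rng_prepend.
Qed.

Lemma L_vertex_shift (j : 'I_n) : P j * U = U * P (ordS j).
Proof.
rewrite !L_vertex_diag diag_op_shift; congr (U * diag_op _).
by apply/funext => i; rewrite (can2_eq (@ord_predK n) (@ordSK n)).
Qed.

Lemma L_vertexM (i j : 'I_n) : P i * P j = if i == j then P i else 0.
Proof.
apply: bop_eq => u; apply: l2_eq => w; rewrite bop_mulE !L_vertex_coord.
have [->|ij] := eqVneq i j.
  by rewrite L_vertex_coord mulrA; case: eqP; rewrite ?mulr1 ?mul0r.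
have [->|] := eqVneq (path_rng w) i; last by rewrite mul0r.
by rewrite (negPf ij) mul0r mulr0.
Qed.

Lemma sum_L_vertex : \sum_j P j = 1.
Proof.
apply: bop_eq => u; apply: l2_eq => w.
have -> : \sum_j P j = diag_op (fun=> 1).
  by apply: eq_bigr => j _; rewrite scale1r.
by rewrite diag_opE mul1r.
Qed.

Lemma L_edge_shift (j : 'I_n) : @L_edge R G j = P j * U.
Proof.
apply: bop_eq => u; apply: l2_eq => w; rewrite bop_mulE L_vertex_coord.
have [[w' ->]|U0] := prependP w.
  rewrite shift_prepend path_rng_prepend (can2_eq (@ord_predK n) (@ordSK n)).
  case: eqP => w'j.
    rewrite mul1r; apply: shift_op_coord; first exact: edge_mul_inj.
    by rewrite edge_mul_prepend w'j eqxx.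
  rewrite mul0r; apply: shift_op_coord0 => w0; rewrite edge_mul_prepend.
  case: eqP => // w0j w0w'; apply: w'j.
  by rewrite -w0j (prepend_inj w0w' erefl).
rewrite U0 mulr0; apply: shift_op_coord0 => w0; rewrite edge_mul_prepend.
case: eqP => // _ [w0w].
(* a path [prepend w0] carries the nonzero coordinate of a shifted vector *)
have /eqP := U0 (l2_delta R w0).
by rewrite -w0w shift_prepend /= eqxx oner_eq0.
Qed.

Lemma graph_algebra_ind (X : set (bop H)) : subalgebra X ->
  (forall j, X (P j)) -> X U ->
  smallest (@subalgebra R H) (range (@L_edge R G) `|` range (@L_vertex R G))
    `<=` X.
Proof.
move=> Xalg XP XU; apply: smallest_sub => // _ [[j _ <-]|[j _ <-]] //.
by rewrite L_edge_shift; have [_ _ _ XM] := Xalg; apply: XM.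
Qed.

Local Notation A0 :=
  (smallest (@subalgebra R H) (range (@L_edge R G) `|` range (@L_vertex R G))).

Let A0_subalgebra : subalgebra A0. Proof. exact: smallest_subalgebra. Qed.

Let A0_sum (F : 'I_n -> bop H) : (forall j, A0 (F j)) -> A0 (\sum_j F j).
Proof.
by have [X0 XD _ _] := A0_subalgebra; move=> XF; elim/big_ind: _.
Qed.

Let A0_L_vertex j : A0 (P j).
Proof. by apply: sub_gen_smallest; right; exists j. Qed.

Let A0_shift : A0 U.
Proof.
rewrite -[U]mul1r -sum_L_vertex mulr_suml; apply: A0_sum => j.
by rewrite -L_edge_shift; apply: sub_gen_smallest; left; exists j.
Qed.

Let A0_diag d : A0 (diag_op d).
Proof. by have [_ _ XZ _] := A0_subalgebra; apply: A0_sum => j; exact: XZ. Qed.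

Let A0_one : A0 1. Proof. by rewrite -sum_L_vertex; exact: A0_sum. Qed.

Lemma graph_algebra_diag d : A (diag_op d).
Proof. exact: sub_closed_algebra. Qed.

Lemma graph_algebra_L_vertex (j : 'I_n) : A (P j).
Proof. exact: sub_closed_algebra. Qed.

Lemma graph_algebra_shift : A U. Proof. exact: sub_closed_algebra. Qed.

Lemma graph_algebra_shiftX k : A (U ^+ k).
Proof.
elim: k => [|k IH]; first by rewrite expr0; exact: sub_closed_algebra.
by rewrite exprS; apply: closed_algebraM => //; exact: graph_algebra_shift.
Qed.

(** The Fourier coefficient of [S] at the path of length [0] at [j]. *)
Definition vertex_coef S (j : 'I_n) : C :=
  S (l2_delta R (vertex_path j)) (vertex_path j).

Definition diag_part S : bop H := diag_op (vertex_coef S).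

Definition shift_quotient S : bop H := V * (S - diag_part S).

Lemma vertex_coef_diag d j : vertex_coef (diag_op d) j = d j.
Proof. by rewrite /vertex_coef diag_opE /= eqxx mulr1. Qed.

Lemma vertex_coefD S T j :
  vertex_coef (S + T) j = vertex_coef S j + vertex_coef T j.
Proof. by rewrite /vertex_coef bop_addE l2_addE. Qed.

Lemma vertex_coefZ c S j : vertex_coef (c *: S) j = c * vertex_coef S j.
Proof. by rewrite /vertex_coef bop_scaleE l2_scaleE. Qed.

Lemma vertex_coefB S T j :
  vertex_coef (S - T) j = vertex_coef S j - vertex_coef T j.
Proof. by rewrite /vertex_coef bop_l2B. Qed.

Lemma vertex_coef_shiftX k S j : (0 < k)%N -> vertex_coef (U ^+ k * S) j = 0.
Proof. by move=> k0; rewrite /vertex_coef bop_mulE shiftX_vertex. Qed.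

Lemma vertex_coef_le S j :
  rnorm (vertex_coef S j) <= rnorm (l2_delta R (vertex_path j)) * opnorm S.
Proof.
rewrite mulrC; apply: le_trans (coord_le_l2norm _ _) _; rewrite -rnorm_l2.
exact: le_opnorm.
Qed.

Let diag_partB S T : diag_part (S - T) = diag_part S - diag_part T.
Proof.
rewrite /diag_part -[- diag_op _]scaleN1r -diag_op_scale -diag_op_sum.
congr diag_op.
by apply/funext => j; rewrite vertex_coefB mulN1r.
Qed.

Let diag_part_bounded : exists K,
  forall S, opnorm (diag_part S) <= K * opnorm S.
Proof.
exists (\sum_j rnorm (l2_delta R (vertex_path j)) * opnorm (P j)) => S.
rewrite mulr_suml /diag_part /diag_op.
elim/big_rec2: _ => [|j y T _ Ty].
  by rewrite -rnorm_bop rnorm0.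
apply: le_trans (opnormD _ _) _; rewrite lerD// opnormZ mulrAC.
by rewrite ler_wpM2r ?opnorm_ge0 ?vertex_coef_le.
Qed.

Let shift_quotientB S T :
  shift_quotient (S - T) = shift_quotient S - shift_quotient T.
Proof. by rewrite /shift_quotient diag_partB -mulrBr opprD addrACA -opprD. Qed.

Let shift_quotient_bounded :
  exists K, forall S, opnorm (shift_quotient S) <= K * opnorm S.
Proof.
have [K SK] := diag_part_bounded; exists (1 + K) => S.
apply: le_trans (opnormM _ _) _.
apply: (@le_trans _ _ (opnorm (S - diag_part S))).
  by rewrite ler_piMl ?opnorm_ge0 ?opnorm_circle_unshift.
by apply: le_trans (opnormB _ _) _; rewrite mulrDl mul1r lerD.
Qed.

Let A0_expansion S : A0 S ->
  exists d, exists2 S', A0 S' & S = diag_op d + U * S'.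
Proof.
have [X0 XD XZ XM] := A0_subalgebra.
pose X : set (bop H) :=
  [set S | exists d, exists2 S', A0 S' & S = diag_op d + U * S'].
suff AX : A0 `<=` X by apply: AX.
apply: graph_algebra_ind.
- split=> [|S1 S2 [d [S' AS' ->]] [e [T' AT' ->]]|c S1 [d [S' AS' ->]]|
      S1 S2 [d [S' AS' ->]] [e [T' AT' ->]]].
  + by exists (fun=> 0); exists 0 => //; rewrite diag_op0 mulr0 addr0.
  + exists (fun i => d i + e i); exists (S' + T'); first exact: XD.
    by rewrite diag_op_sum mulrDr addrACA.
  + exists (fun i => c * d i); exists (c *: S'); first exact: XZ.
    by rewrite diag_op_scale bop_scalerAr scalerDr.
  + exists (fun i => d i * e i).
    exists (diag_op (fun i => d (ord_pred i)) * T' + S' * (diag_op e + U * T')).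
      apply: (XD _ _ (XM _ _ (A0_diag _) AT')).
      exact: (XM _ _ AS' (XD _ _ (A0_diag e) (XM _ _ A0_shift AT'))).
    rewrite diag_op_mul [LHS]mulrDl.
    rewrite [diag_op d * (_ + _)]mulrDr -addrA [in RHS]mulrDr.
    by rewrite !mulrA diag_op_shift.
- move=> j; exists (fun i => (i == j)%:R); exists 0 => //.
  by rewrite mulr0 addr0 -L_vertex_diag.
- by exists (fun=> 0); exists 1 => //; rewrite diag_op0 add0r mulr1.
Qed.

Let A0_shift_quotient S : A0 S ->
  A0 (shift_quotient S) /\ S = diag_part S + U * shift_quotient S.
Proof.
move=> /A0_expansion[d [S' AS' SE]].
have dE : diag_part S = diag_op d.
  congr diag_op; apply/funext => j.
  rewrite SE vertex_coefD vertex_coef_diag -[U]expr1.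
  by rewrite vertex_coef_shiftX ?addr0.
have -> : shift_quotient S = S'.
  by rewrite /shift_quotient dE SE addrC addKr mulrA unshiftK mul1r.
by rewrite dE.
Qed.

Lemma graph_algebra_quotient S : A S -> A (shift_quotient S).
Proof.
have [K SK] := shift_quotient_bounded.
apply: (bounded_additive_closed_algebra shift_quotientB SK) => T.
by move=> /A0_shift_quotient[AT _]; exact: sub_closed_algebra.
Qed.

(** One step of the Taylor expansion of an element of the algebra: the operator
    coefficient is diagonal, and by [graph_algebra_quotient] the remainder is
    again in the algebra.  Both sides are bounded in [S], so the identity passes
    from polynomials in the generators to their limits. *)
Lemma graph_algebra_expansion S : A S ->
  S = diag_part S + U * shift_quotient S.
Proof.
have [K SK] := diag_part_bounded; have [L SL] := shift_quotient_bounded.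
move=> AS; apply/eqP; rewrite -subr_eq0; apply/eqP; move: S AS.
apply: (@bounded_additive_closed_algebra0 _ _ _
  (fun S => S - (diag_part S + U * shift_quotient S)) (1 + (K + L))).
- move=> S T; rewrite diag_partB shift_quotientB mulrBr.
  rewrite (addrACA (diag_part S)) -opprD (opprD (diag_part S + _)).
  by rewrite addrACA -opprD.
- move=> S; apply: le_trans (opnormB _ _) _; rewrite !mulrDl mul1r lerD2l.
  apply: le_trans (opnormD _ _) _; rewrite lerD//.
  apply: le_trans (opnormM _ _) _; apply: le_trans (SL S).
  by rewrite ler_piMl ?opnorm_ge0 ?opnorm_circle_shift.
- by move=> S /A0_shift_quotient[_ <-]; rewrite subrr.
Qed.

End circle.

(** * Derivations of a closed algebra *)

Section derivations.
Variables (R : realType) (W : normedModType R[i]) (G : set (bop W)).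
Local Notation A := (closed_algebra G).
Implicit Types (S T : bop W) (delta : bop W -> bop W).

Lemma closed_algebra_lim T :
  (forall e : R, 0 < e -> exists2 S, A S & opnorm (T - S) < e) -> A T.
Proof.
move=> TA; apply/closed_algebraP => e e0.
have [|S /closed_algebraP/(_ (e / 2)) AS TS] := TA (e / 2).
  by rewrite divr_gt0.
case: AS => [|S0 GS0 SS0]; first by rewrite divr_gt0.
exists S0 => //; rewrite -[T](subrK S) -addrA [ltRHS]splitr.
by apply: le_lt_trans (opnormD _ _) _; rewrite ltrD.
Qed.

Section one_derivation.
Variable delta : bop W -> bop W.
Hypothesis der : derivation_on A delta.

Lemma derivationA S : A S -> A (delta S).
Proof. by have [der_A _ _] := der => AS; exact: der_A. Qed.

Lemma derivationM S T : A S -> A T -> delta (S * T) = delta S * T + S * delta T.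
Proof. by have [_ _ der_M] := der => AS AT; exact: der_M. Qed.

Lemma derivation0 : delta 0 = 0.
Proof.
have [_ der_lin _] := der; have A0 := @closed_algebra0 _ _ G.
have := der_lin 1 _ _ A0 A0; rewrite !scale1r addr0 => /eqP.
by rewrite -subr_eq0 opprD addrA subrr sub0r oppr_eq0 => /eqP.
Qed.

Lemma derivationD S T : A S -> A T -> delta (S + T) = delta S + delta T.
Proof.
have [_ der_lin _] := der => AS AT.
by rewrite -[S in LHS]scale1r der_lin// scale1r.
Qed.

Lemma derivationZ c S : A S -> delta (c *: S) = c *: delta S.
Proof.
have [_ der_lin _] := der => AS; rewrite -[c *: S]addr0 der_lin//.
  by rewrite derivation0 addr0.
exact: closed_algebra0.
Qed.

Lemma derivation_sum (J : Type) (s : seq J) (F : J -> bop W) :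
  (forall j, A (F j)) -> delta (\sum_(j <- s) F j) = \sum_(j <- s) delta (F j).
Proof.
move=> AF; elim: s => [|j s IH]; first by rewrite !big_nil derivation0.
by rewrite !big_cons derivationD ?IH//; exact: closed_algebra_sum.
Qed.

Lemma derivation1 : A 1 -> delta 1 = 0.
Proof.
move=> A1; have := derivationM A1 A1; rewrite !mul1r mulr1 => /eqP.
by rewrite -subr_eq0 opprD addrA subrr sub0r oppr_eq0 => /eqP.
Qed.

Lemma derivationX S k : A 1 -> A S -> S * delta S = delta S * S ->
  delta (S ^+ k.+1) = (S ^+ k * delta S) *+ k.+1.
Proof.
move=> A1 AS SdS.
have AX m : A (S ^+ m).
  by elim: m => // m IH; rewrite exprS; exact: closed_algebraM.
elim: k => [|k IH]; first by rewrite expr1 expr0 mul1r.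
rewrite exprSr derivationM// IH mulrnAl -mulrA -SdS.
by rewrite mulrA -!exprSr -mulrSr.
Qed.

Lemma derivationB_inner T : A T ->
  derivation_on A (fun S => delta S - inner_derivation T S).
Proof.
have [der_A der_lin der_M] := der; move=> AT; rewrite /inner_derivation.
split=> [S AS|c S1 S2 AS1 AS2|S1 S2 AS1 AS2].
- by apply: closed_algebraB; [exact: der_A|
    apply: closed_algebraB; exact: closed_algebraM].
- rewrite der_lin// mulrDl mulrDr bop_scalerAl bop_scalerAr.
  have -> : c *: (S1 * T) + S2 * T - (c *: (T * S1) + T * S2) =
      c *: (S1 * T - T * S1) + (S2 * T - T * S2).
    by rewrite opprD addrACA -scalerBr.
  by rewrite [X in _ = X + _]scalerBr opprD addrACA.
- rewrite der_M// [in RHS]mulrBl [in RHS]mulrBr addrACA -opprD.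
  by congr (_ - _); rewrite mulrBl mulrBr !mulrA [RHS]addrC addrA subrK.
Qed.

End one_derivation.
End derivations.

(** * Lacunary series in the shift *)

Section circle_derivation.
Variables (R : realType) (n : nat).
Local Notation C := R[i].
Local Notation G := (circle_graph n).
Local Notation H := (l2 R (dpath G)).
Local Notation U := (circle_shift R n).
Local Notation V := (circle_unshift R n).
Local Notation P := (@L_vertex R G).
Local Notation A := (graph_algebra R G).
Implicit Types (S T : bop H).

Lemma graph_algebra1 : A 1.
Proof. by rewrite -(expr0 U); exact: graph_algebra_shiftX. Qed.

Lemma rnorm_real_ge0 (a : R) : 0 <= a -> rnorm (a%:C : C) = a.
Proof. by move=> a0; apply: complexI; rewrite -rnormE ger0_norm// lecR. Qed.

Lemma pow2V_small (e : R) : 0 < e -> exists K, 2 * 2^-1 ^+ K < e.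
Proof.
move=> e0; have [K Ke] : exists K, 2 / e < K%:R.
  exists (Num.Def.archi_bound (2 / e)); apply: archi_boundP.
  by rewrite divr_ge0// ltW.
exists K; rewrite exprVn ltr_pdivrMr ?exprn_gt0// mulrC -ltr_pdivrMr//.
by apply: lt_le_trans Ke _; rewrite -natrX ler_nat ltnW// ltn_expl.
Qed.

Section lacunary.
Variable e : nat -> nat.
Hypothesis e_inc : forall m, (e m < e m.+1)%N.

Let e_ge m : (m <= e m)%N.
Proof. by elim: m => // m IH; exact: leq_ltn_trans IH (e_inc m). Qed.

Let e_mono m m' : (m <= m')%N -> (e m <= e m')%N.
Proof.
exact: (homo_leq (fun _ => leqnn _) leq_trans (fun m => ltnW (e_inc m))).
Qed.

Let T K : bop H := \sum_(0 <= i < K) (2^-1 ^+ i)%:C *: U ^+ e i.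

Let T_tail K K' : (K <= K')%N ->
  T K' - T K = \sum_(K <= i < K') (2^-1 ^+ i)%:C *: U ^+ e i.
Proof.
by move=> KK'; apply/eqP; rewrite subr_eq addrC /T -(@big_cat_nat _ _ _ K).
Qed.

Let T_small K K' : (K <= K')%N -> opnorm (T K' - T K) <= 2 * 2^-1 ^+ K.
Proof.
move=> KK'; suff : opnorm (T K' - T K) <= 2 * 2^-1 ^+ K - 2 * 2^-1 ^+ K'.
  by move/le_trans; apply; rewrite gerBl mulr_ge0// exprn_ge0// invr_ge0.
rewrite T_tail//; elim: K' KK' => [|K' IH].
  by rewrite leqn0 => /eqP ->; rewrite big_geq// -rnorm_bop rnorm0 subrr.
rewrite leq_eqVlt => /predU1P[->|KK'].
  by rewrite big_geq// -rnorm_bop rnorm0 subrr.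
rewrite big_nat_recr//=; apply: le_trans (opnormD _ _) _.
apply: le_trans (lerD (IH KK') (opnormZX _ _ (opnorm_circle_shift R n))) _.
rewrite rnorm_real_ge0 ?exprn_ge0 ?invr_ge0// exprS mulrA.
rewrite divff ?pnatr_eq0// mul1r.
by rewrite -addrA lerD2l; lra.
Qed.

(** The weights are summable, so the series converges in norm whatever the
    exponents are; they can be chosen so that its formal derivative has
    unbounded coefficients.  Each tail is divisible by the first power of the
    shift that occurs in it because the condition [U ^+ k * V ^+ k * S = S] is
    closed. *)
Lemma lacunary_series : exists2 F, A F & forall M, exists2 Y, A Y &
  F = \sum_(0 <= i < M) (2^-1 ^+ i)%:C *: U ^+ e i + U ^+ e M * Y.
Proof.
have AT K : A (T K).
  apply: closed_algebra_sum => i; apply: closed_algebraZ.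
  exact: graph_algebra_shiftX.
have [w K u|F FT] := @stabilizing_limit R (dpath G) T
    (fun w => (path_length w).+1) (fun K => 2 * 2^-1 ^+ K) _ T_small.
  move=> wK; rewrite -[T K](subrK (T (path_length w).+1)) T_tail//.
  rewrite bop_addE l2_addE bop_sumE big_nat big1 ?add0r// => i /andP[wi _].
  rewrite bop_scaleE l2_scaleE shiftX_coord0 ?mulr0//.
  exact: leq_trans wi (e_ge i).
have V1 := opnormX_le1 _ (opnorm_circle_unshift R n).
have U1 := opnormX_le1 _ (opnorm_circle_shift R n).
have half_max M K : 2 * 2^-1 ^+ maxn M K <= 2 * 2^-1 ^+ K :> R.
  rewrite ler_pM2l ?ltr0n//; apply: ler_wiXn2l; last exact: leq_maxr.
    by rewrite invr_ge0 ler0n.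
  by rewrite invf_le1 ?ler1n ?ltr0n.
have V_tail M K : (M <= K)%N -> A (V ^+ e M * (T K - T M)) /\
    U ^+ e M * (V ^+ e M * (T K - T M)) = T K - T M.
  move=> MK.
  pose D := \sum_(M <= i < K) (2^-1 ^+ i)%:C *: U ^+ (e i - e M) : bop H.
  have UD : U ^+ e M * D = T K - T M.
    rewrite T_tail// mulr_sumr; apply: eq_big_nat => i /andP[Mi _].
    by rewrite bop_scalerAr -exprD subnKC// e_mono.
  have -> : V ^+ e M * (T K - T M) = D by rewrite -UD mulrA unshiftXK mul1r.
  split=> //; apply: closed_algebra_sum => i; apply: closed_algebraZ.
  exact: graph_algebra_shiftX.
exists F.
  apply: closed_algebra_lim => eps /pow2V_small[K Keps].
  by exists (T K); [exact: AT|exact: le_lt_trans (FT K) Keps].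
move=> M; exists (V ^+ e M * (F - T M)).
  apply: closed_algebra_lim => eps /pow2V_small[K Keps].
  exists (V ^+ e M * (T (maxn M K) - T M)).
    by have [] := V_tail M (maxn M K) (leq_maxl _ _).
  rewrite -mulrBr opprB addrA subrK; apply: le_lt_trans (opnormM _ _) _.
  apply: le_lt_trans Keps; apply: (@le_trans _ _ (opnorm (F - T (maxn M K)))).
    by rewrite ler_piMl ?opnorm_ge0.
  exact: le_trans (FT _) (half_max M K).
apply/eqP; rewrite addrC -subr_eq eq_sym -subr_eq0; apply/eqP/opnorm0_eq0/eqP.
rewrite eq_le opnorm_ge0 andbT; apply/ler_addgt0Pr => eps eps0; rewrite add0r.
have [K Keps] := pow2V_small (divr_gt0 eps0 (ltr0Sn R 1)).
have [_ VT] := V_tail M (maxn M K) (leq_maxl _ _).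
have -> : U ^+ e M * (V ^+ e M * (F - T M)) - (F - T M) =
    U ^+ e M * (V ^+ e M * (F - T (maxn M K))) - (F - T (maxn M K)).
  have -> : F - T M = (F - T (maxn M K)) + (T (maxn M K) - T M).
    by rewrite addrA subrK.
  rewrite [V ^+ e M * (_ + _)]mulrDr [U ^+ e M * (_ + _)]mulrDr VT.
  by rewrite [X in _ - X]addrC addrKA.
apply: le_trans (opnormB _ _) _; rewrite [leRHS]splitr.
have FK : opnorm (F - T (maxn M K)) <= eps / 2.
  exact: le_trans (FT _) (le_trans (half_max M K) (ltW Keps)).
rewrite lerD//; apply: le_trans (opnormM _ _) _.
apply: (@le_trans _ _ (opnorm (V ^+ e M * (F - T (maxn M K))))).
  by rewrite ler_piMl ?opnorm_ge0.
apply: le_trans (opnormM _ _) _; apply: le_trans FK.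
by rewrite ler_piMl ?opnorm_ge0.
Qed.

End lacunary.
End circle_derivation.

(** * Derivations of the algebra of the circle graph *)

Section circle_main.
Variables (R : realType) (n : nat).
Local Notation C := R[i].
Local Notation G := (circle_graph n).
Local Notation H := (l2 R (dpath G)).
Local Notation U := (circle_shift R n).
Local Notation V := (circle_unshift R n).
Local Notation P := (@L_vertex R G).
Local Notation A := (graph_algebra R G).
Implicit Types (S T : bop H).

Lemma iter_ordS k (j : 'I_n) : iter k (@ordS n) j = ((j + k) %% n)%N :> nat.
Proof.
elim: k => [|k IH]; first by rewrite addn0 modn_small.
by rewrite iterS /= IH -addn1 modnDml addn1 addnS.
Qed.

Lemma L_vertex_shiftX (j : 'I_n) k :
  P j * U ^+ k = U ^+ k * P (iter k (@ordS n) j).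
Proof.
elim: k j => [|k IH] j; first by rewrite expr0 mul1r mulr1.
by rewrite exprS mulrA L_vertex_shift -[LHS]mulrA IH [LHS]mulrA iterSr.
Qed.

Lemma circle_cycle_central S : A S -> U ^+ n * S = S * U ^+ n.
Proof.
move=> AS; apply/eqP; rewrite -subr_eq0; apply/eqP; move: S AS.
apply: (@bounded_additive_closed_algebra0 _ _ _
  (fun S => U ^+ n * S - S * U ^+ n) (opnorm (U ^+ n) + opnorm (U ^+ n))).
- by move=> S T; rewrite mulrBr mulrBl opprD addrACA -opprD.
- move=> S; apply: le_trans (opnormB _ _) _; rewrite mulrDl.
  by rewrite lerD ?opnormM// [leRHS]mulrC opnormM.
suff AX : smallest (@subalgebra R H)
      (range (@L_edge R G) `|` range (@L_vertex R G)) `<=`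
    [set S | U ^+ n * S = S * U ^+ n].
  by move=> S /AX ->; rewrite subrr.
apply: graph_algebra_ind => /=.
- split=> /= [|S T ZS ZT|c S ZS|S T ZS ZT].
  + by rewrite mulr0 mul0r.
  + by rewrite mulrDr mulrDl ZS ZT.
  + by rewrite bop_scalerAl bop_scalerAr ZS.
  + by rewrite mulrA ZS -mulrA ZT mulrA.
- move=> j; rewrite L_vertex_shiftX; congr (_ * P _); apply/val_inj => /=.
  by rewrite iter_ordS modnDr modn_small.
- by rewrite -exprS -exprSr.
Qed.

(** Otherwise all terms of the expansion along the shift would vanish, and [S]
    would be divisible by all powers of the shift. *)
Lemma graph_algebra_leading S : A S -> S <> 0 ->
  exists k g j, [/\ A g, S = U ^+ k * g & vertex_coef g j <> 0].
Proof.
move=> AS; apply: contra_notP => S_lead; apply: shiftX_divisible_eq0 => k.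
suff [g _ ->] : exists2 g, A g & S = U ^+ k * g by exists g.
elim: k => [|k [g Ag SE]]; first by exists S => //; rewrite mul1r.
exists (shift_quotient g); first exact: graph_algebra_quotient.
rewrite SE {1}(graph_algebra_expansion Ag) mulrDr mulrA -exprSr.
suff -> : diag_part g = 0 by rewrite mulr0 add0r.
rewrite -(diag_op0 R n); congr diag_op; apply/funext => j.
apply: contrapT => gj.
by apply: S_lead; exists k, g, j.
Qed.

Lemma sum_fact_le m : (\sum_(0 <= i < m.+1) i`! <= 2 * m`!)%N.
Proof.
elim: m => [|m IH]; first by rewrite big_nat1.
case: m IH => [_|m IH]; first by rewrite unlock.
rewrite big_nat_recr//= mul2n -addnn leq_add2r; apply: leq_trans IH _.
by rewrite [leqRHS]factS leq_mul.
Qed.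

Section coefficient.
Variable (j : 'I_n).

(** The Fourier coefficient of [S] at the path of length [K] with source [j],
    read off after shifting back: this makes it bounded uniformly in [K]. *)
Let chi K S : C := vertex_coef (V ^+ K * S) j.

Let chiD K S T : chi K (S + T) = chi K S + chi K T.
Proof. by rewrite /chi mulrDr vertex_coefD. Qed.

Let chiZ K c S : chi K (c *: S) = c * chi K S.
Proof. by rewrite /chi bop_scalerAr vertex_coefZ. Qed.

Let chi_sum K m (F : nat -> bop H) :
  chi K (\sum_(0 <= i < m) F i) = \sum_(0 <= i < m) chi K (F i).
Proof.
elim: m => [|m IH]; last by rewrite !big_nat_recr//= chiD IH.
rewrite !big_geq// -(scale0r (0 : bop H)) chiZ mul0r//.
Qed.

Let chi_le K S :
  rnorm (chi K S) <= rnorm (l2_delta R (vertex_path j)) * opnorm S.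
Proof.
apply: le_trans (vertex_coef_le _ _) _; rewrite ler_wpM2l ?rnorm_ge0//.
apply: le_trans (opnormM _ _) _; rewrite ler_piMl ?opnorm_ge0//.
exact: opnormX_le1 (opnorm_circle_unshift R n).
Qed.

Let chi_gt K m S : (K < m)%N -> chi K (U ^+ m * S) = 0.
Proof.
move=> Km; rewrite -(subnKC (ltnW Km)) exprD /chi !mulrA unshiftXK mul1r.
by rewrite vertex_coef_shiftX// subn_gt0.
Qed.

Let chi_le_shift K m S : (m <= K)%N -> chi K (U ^+ m * S) = chi (K - m) S.
Proof.
move=> mK; rewrite /chi -[in LHS](subnK mK) exprD -mulrA.
by rewrite [V ^+ m * _]mulrA unshiftXK mul1r.
Qed.

(** Let [F] be the series with weights [2^-i] and exponents [N i] in the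
    variable [U ^+ n].  Then [delta F] is formally the sum over [i] of
    [2^-i * N i] times [U ^+ (n * (N i - 1) + k) * g].  If [2^-i * N i] is
    [i`!], its coefficient of length [n * (N M - 1) + k] is [M`!] times [vertex_coef g j] up to an error
    of order [(M - 1)`!] due to the terms with [i < M], and it has to stay
    bounded as [M] grows. *)
Lemma derivation_cycle_coef delta k g : (0 < n)%N -> derivation_on A delta ->
  A g -> delta (U ^+ n) = U ^+ k * g -> vertex_coef g j = 0.
Proof.
move=> n0 der Ag dZ; apply: rnorm0_eq0; apply/eqP; apply: contraT => gj.
have {gj} gj : 0 < rnorm (vertex_coef g j) by rewrite lt0r gj rnorm_ge0.
have A1 : A 1 by exact: graph_algebra1.
have AU m : A (U ^+ m) by exact: graph_algebra_shiftX.
have dZX N : delta (U ^+ (n * N.+1)) = (U ^+ (n * N + k) * g) *+ N.+1.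
  rewrite exprM (derivationX der _ A1 (AU n)); last first.
    by apply: circle_cycle_central; exact: (derivationA der (AU n)).
  by rewrite -exprM dZ mulrA -exprD.
pose N m := (2 ^ m * m`!)%N.
have N_gt0 m : (0 < N m)%N by rewrite muln_gt0 expn_gt0 fact_gt0.
have N_inc m : (N m + m < N m.+1)%N.
  have mN : (m < N m)%N.
    by apply: leq_trans (ltn_expl m (ltnSn 1)) _; rewrite leq_pmulr ?fact_gt0.
  apply: (@leq_trans (2 * N m)%N); first by rewrite mul2n -addnn ltn_add2l.
  by rewrite /N expnS mulnA leq_pmul2l ?muln_gt0 ?expn_gt0// factS leq_pmull.
have e_inc m : (n * N m < n * N m.+1)%N.
  by rewrite ltn_pmul2l//; apply: leq_ltn_trans (N_inc m); rewrite leq_addr.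
have [F AF FE] := @lacunary_series R n (fun m => (n * N m)%N) e_inc.
set c := rnorm (l2_delta R (vertex_path j)).
have c0 : 0 <= c by exact: rnorm_ge0.
have growth m : (k <= m.+1)%N ->
    m.+1%:R * rnorm (vertex_coef g j) <=
      c * opnorm (delta F) + 2 * (c * opnorm g).
  move=> km; pose M := m.+1; pose K := (n * (N M).-1 + k)%N.
  have [Y AY FM] := FE M.+1.
  have NM_pred : ((N M).-1 < (N M.+1).-1)%N.
    rewrite -ltnS !prednK//; apply: leq_ltn_trans (N_inc M).
    by rewrite leq_addr.
  (* K lies below both exponents that occur in the derivative of the tail *)
  have KM1 : (K < n * N M.+1)%N.
    apply: (@leq_ltn_trans (n * (N M + M))%N); last by rewrite ltn_pmul2l.
    rewrite mulnDr leq_add//; first by rewrite leq_mul2l leq_pred orbT.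
    by apply: leq_trans km _; rewrite leq_pmull.
  have KM2 : (K < n * (N M.+1).-1 + k)%N by rewrite ltn_add2r ltn_pmul2l.
  pose t i := chi (K - (n * (N i).-1 + k)) g.
  have term i : (i <= M)%N ->
      chi K (delta ((2^-1 ^+ i)%:C *: U ^+ (n * N i))) = (i`!%:R : R)%:C * t i.
    move=> iM; rewrite (derivationZ der _ (AU _)).
    rewrite -[in U ^+ (n * N i)](prednK (N_gt0 i)).
    rewrite dZX prednK// -scalerMnr scalerMnl chiZ chi_le_shift; last first.
      rewrite leq_add2r leq_mul2l -ltnS !prednK// (_ : _ <= _)%N ?orbT//.
      move: iM; apply: (homo_leq (fun _ => leqnn _) leq_trans) => m'.
      by apply: leq_trans (ltnW (N_inc m')); rewrite leq_addr.
    congr (_ * _); rewrite -rmorphMn; congr (_%:C).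
    by rewrite -mulr_natr natrM natrX exprVn mulrA mulVf ?mul1r.
  have tail0 : chi K (delta (U ^+ (n * N M.+1) * Y)) = 0.
    rewrite (derivationM der (AU _) AY) chiD chi_gt// addr0.
    rewrite -[in U ^+ (n * N _)](prednK (N_gt0 M.+1)) dZX mulrnAl -mulrA.
    by rewrite -mulrnAr chi_gt.
  have dF : chi K (delta F) =
      \sum_(0 <= i < M) (i`!%:R : R)%:C * t i +
      (M`!%:R : R)%:C * vertex_coef g j.
    have Aterm i : A ((2^-1 ^+ i)%:C *: U ^+ (n * N i)).
      exact: closed_algebraZ (AU _).
    have AT : A (\sum_(0 <= i < M.+1) (2^-1 ^+ i)%:C *: U ^+ (n * N i)).
      by apply: closed_algebra_sum => i; exact: Aterm.
    rewrite FM (derivationD der AT (closed_algebraM (AU _) AY)).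
    rewrite (derivation_sum der); last exact: Aterm.
    rewrite chiD tail0 addr0 chi_sum big_nat_recr//=; congr (_ + _).
      by apply: eq_big_nat => i /andP[_ /ltnW/term].
    by rewrite term// /t subnn /chi expr0 mul1r.
  have t_le i : rnorm (t i) <= c * opnorm g by exact: chi_le.
  have S_le : rnorm (\sum_(0 <= i < M) (i`!%:R : R)%:C * t i) <=
      (2 * m`!)%:R * (c * opnorm g).
    apply: (@le_trans _ _ (\sum_(0 <= i < M) i`!%:R * (c * opnorm g))).
      elim/big_rec2: _ => [|i y x _ xy]; first by rewrite rnorm0.
      apply: le_trans (ler_rnormD _ _) _; rewrite lerD// rnormM.
      by rewrite rnorm_real_ge0// ler_wpM2l.
    rewrite -mulr_suml ler_wpM2r ?mulr_ge0 ?opnorm_ge0//.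
    by rewrite -natr_sum ler_nat sum_fact_le.
  have : M`!%:R * rnorm (vertex_coef g j) <=
      c * opnorm (delta F) + (2 * m`!)%:R * (c * opnorm g).
    rewrite -[X in X * _]rnorm_real_ge0// -rnormM.
    rewrite (_ : _ * _ = chi K (delta F) -
      \sum_(0 <= i < M) (i`!%:R : R)%:C * t i); last by rewrite dF addrC addKr.
    have rnormN x : rnorm (- x : C) = rnorm x by rewrite /rnorm normrN.
    by apply: le_trans (ler_rnormD _ _) _; rewrite rnormN lerD.
  have m_ge1 : 1 <= m`!%:R :> R by rewrite ler1n fact_gt0.
  have m_gt0 : 0 < m`!%:R :> R by rewrite ltr0n fact_gt0.
  have -> : M`!%:R = m`!%:R * m.+1%:R :> R by rewrite /M factS mulnC natrM.
  rewrite -mulrA natrM => vc_le; rewrite -(ler_pM2l m_gt0).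
  apply: le_trans vc_le _; rewrite mulrDr lerD//.
    by rewrite ler_peMl// mulr_ge0 ?opnorm_ge0.
  by rewrite -mulrA mulrCA.
set B := c * opnorm (delta F) + 2 * (c * opnorm g) in growth.
have B0 : 0 <= B by rewrite addr_ge0 ?mulr_ge0 ?opnorm_ge0.
pose b := Num.Def.archi_bound (B / rnorm (vertex_coef g j)).
pose m := maxn k b.
have := growth m (leqW (leq_maxl _ _)).
rewrite -ler_pdivlMr// leNgt => /negP[].
apply: (@lt_le_trans _ _ b%:R).
  by apply: archi_boundP; rewrite divr_ge0// ltW.
by rewrite ler_nat leqW// leq_maxr.
Qed.

End coefficient.

(** On polynomials alone there are derivations that do not vanish here, such as
    the one with [delta U = U] that kills the projections; the norm limits
    exclude them, through [derivation_cycle_coef]. *)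
Lemma derivation_cycle0 delta : (0 < n)%N -> derivation_on A delta ->
  delta (U ^+ n) = 0.
Proof.
move=> n0 der; have AZ : A (U ^+ n) by exact: graph_algebra_shiftX.
apply: contrapT => /(graph_algebra_leading (derivationA der AZ)).
by move=> [k [g [j [Ag dZ]]]]; apply; exact: derivation_cycle_coef n0 der Ag dZ.
Qed.

(** For orthogonal idempotents [P i] with sum [1], differentiating
    [P i * P j = 0] gives [P i * delta (P j) = - delta (P i) * P j], from which
    [\sum_i P i * delta (P i)] is seen to implement [delta] on them. *)
Lemma derivation_vertex_inner delta : derivation_on A delta ->
  exists2 T, A T & forall j, delta (P j) = inner_derivation T (P j).
Proof.
move=> der; have AP j : A (P j) by exact: graph_algebra_L_vertex.
exists (\sum_i P i * delta (P i)) => [|j].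
  apply: closed_algebra_sum => i; apply: closed_algebraM; first exact: AP.
  have Ad : A (delta (P i)) := derivationA der (AP i).
  exact: Ad.
rewrite /inner_derivation mulr_sumr mulr_suml.
have -> : \sum_i P j * (P i * delta (P i)) = P j * delta (P j).
  rewrite (bigD1 (j : 'I_n))//= big1 => [|i ij].
    by rewrite addr0 mulrA L_vertexM eqxx.
  by rewrite mulrA L_vertexM eq_sym (negPf ij) mul0r.
have -> : \sum_i P i * delta (P i) * P j =
    \sum_i P i * delta (P i * P j) - \sum_i P i * delta (P j).
  rewrite -sumrB; apply: eq_bigr => i _.
  by rewrite (derivationM der (AP i) (AP j)) mulrDr !mulrA L_vertexM eqxx addrK.
rewrite -mulr_suml sum_L_vertex mul1r opprB addrC.
rewrite (bigD1 (j : 'I_n))//= big1 => [|i ij].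
  by rewrite addr0 L_vertexM eqxx subrK.
by rewrite L_vertexM (negPf ij) (derivation0 der) mulr0.
Qed.

(** The commutation relation of [S] is that of [U ^+ k]; for [k < n] it excludes
    every path of length less than [k], as such a path has its range and source
    at the wrong distance. *)
Lemma graph_algebra_divisible k S : (k < n)%N -> A S ->
  (forall j : 'I_n, P j * S = S * P (iter k (@ordS n) j)) ->
  exists2 T, A T & S = U ^+ k * T.
Proof.
elim: k S => [|k IH] S kn AS PS; first by exists S => //; rewrite mul1r.
have SE : S = U * shift_quotient S.
  rewrite {1}(graph_algebra_expansion AS) -[RHS]add0r; congr (_ + _).
  rewrite -(diag_op0 R n); congr diag_op; apply/funext => j.
  have : (P j * S) (l2_delta R (vertex_path j)) (vertex_path j) =
      (S * P (iter k.+1 (@ordS n) j)) (l2_delta R (vertex_path j))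
        (vertex_path j).
    by rewrite PS.
  rewrite !bop_mulE L_vertex_coord eqxx mul1r /vertex_coef => ->.
  rewrite L_vertexE ifN ?linear0//.
  apply/eqP => /(congr1 (@nat_of_ord n)); rewrite iter_ordS.
  change (j = ((j + k.+1) %% n)%N :> nat -> False); apply/eqP; rewrite neq_ltn.
  have [jk|jk] := ltnP (j + k.+1) n.
    by rewrite modn_small// addnS ltnS leq_addr.
  by rewrite -(subnK jk) modnDr modn_small; have := ltn_ord j; lia.
have [|j|T AT QE] := IH (shift_quotient S) (ltnW kn) _ _.
- exact: graph_algebra_quotient.
- apply: (@shiftX_inj R n 1); rewrite /= expr1 [LHS]mulrA [RHS]mulrA -SE.
  rewrite -[j](ord_predK j).
  by rewrite -L_vertex_shift -mulrA -SE PS iterSr.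
- by exists T => //; rewrite SE QE mulrA -exprS.
Qed.

(** If the shift were invertible, the mean of [U ^- k * delta (U ^+ k)] over
    [k < n] would do: this averages over the powers of [U], which are periodic
    modulo the central element [U ^+ n] that the derivation kills.  Here the
    quotients [tau k] stand for [U ^- k * delta (U ^+ k)]. *)
Lemma derivation_shift_inner delta : (0 < n)%N -> derivation_on A delta ->
  (forall j, delta (P j) = 0) ->
  exists T, [/\ A T, delta U = inner_derivation T U &
    forall j, inner_derivation T (P j) = 0].
Proof.
move=> n0 der dP.
have AU k : A (U ^+ k) by exact: graph_algebra_shiftX.
have AP j : A (P j) by exact: graph_algebra_L_vertex.
have PdU k (j : 'I_n) :
    P j * delta (U ^+ k) = delta (U ^+ k) * P (iter k (@ordS n) j).
  have := congr1 delta (L_vertex_shiftX j k).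
  rewrite (derivationM der (AP _) (AU _)) (derivationM der (AU _) (AP _)).
  by rewrite !dP mul0r mulr0 add0r addr0.
have tauP k : exists T, (k <= n)%N -> A T /\ delta (U ^+ k) = U ^+ k * T.
  have [kn|kn] := ltnP k n.
    have AdU := derivationA der (AU k).
    have [T AT dE] := graph_algebra_divisible kn AdU (PdU k).
    by exists T.
  exists 0 => kn'; have -> : k = n by apply/eqP; rewrite eqn_leq kn'.
  rewrite (derivation_cycle0 n0 der) mulr0.
  by split=> //; exact: closed_algebra0.
have [tau tauE] := choice tauP.
have tau_end k : (k <= n)%N -> delta (U ^+ k) = 0 -> tau k = 0.
  move=> kn dk; apply: (@shiftX_inj R n k).
  by have [_ <-] := tauE _ kn; rewrite dk mulr0.
have tau0 : tau 0%N = 0.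
  apply: tau_end => //; rewrite expr0 (derivation1 der)//.
  exact: graph_algebra1.
have taun : tau n = 0 by apply: tau_end => //; exact: derivation_cycle0.
have tauS k : (k < n)%N -> U * tau k.+1 - tau k * U = delta U.
  move=> kn; apply: (@shiftX_inj R n k) => /=.
  have [_ dk] := tauE _ (ltnW kn); have [_ dk1] := tauE _ kn.
  rewrite mulrBr !mulrA -dk -exprSr -dk1 exprSr.
  by rewrite (derivationM der (AU k) (AU 1%N)) addrC addKr.
have tauPc k (j : 'I_n) : (k <= n)%N -> P j * tau k = tau k * P j.
  move=> kn; apply: (@shiftX_inj R n k) => /=; have [_ dk] := tauE _ kn.
  have [i <-] : exists i, iter k (@ordS n) i = j.
    exists (iter k (@ord_pred n) j); elim: k {kn dk} => // k IH.
    by rewrite iterSr [iter k.+1 _ j]iterS ord_predK.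
  by rewrite [LHS]mulrA [RHS]mulrA -L_vertex_shiftX -[LHS]mulrA -dk PdU.
exists (n%:R^-1 *: \sum_(0 <= k < n) tau k); split=> [||j].
- apply: closed_algebraZ; rewrite big_nat; elim/big_ind: _ => [||k].
  + exact: closed_algebra0.
  + by move=> S T; exact: closed_algebraD.
  + by move=> /andP[_ /ltnW/tauE[]].
(* the relations tauS telescope because tau takes the same value at 0 and n *)
- have tau_shift : \sum_(0 <= k < n) tau k = \sum_(0 <= k < n) tau k.+1.
    have := erefl (\sum_(0 <= k < n.+1) tau k).
    by rewrite {1}big_nat_recr//= big_nat_recl//= tau0 taun addr0 add0r.
  rewrite /inner_derivation bop_scalerAl bop_scalerAr -scalerBr {1}tau_shift.
  rewrite mulr_sumr mulr_suml -sumrB (eq_big_nat _ _ (F2 := fun=> delta U)).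
    rewrite sumr_const_nat subn0 -(scaler_nat n (delta U)) scalerA.
    rewrite mulVf ?scale1r//.
    by rewrite pnatr_eq0 -lt0n.
  by move=> k /andP[_ /tauS].
- rewrite /inner_derivation bop_scalerAl bop_scalerAr mulr_sumr mulr_suml.
  rewrite (eq_big_nat _ _ (F2 := fun k => tau k * P j)) ?subrr// => k.
  by case/andP=> _ /ltnW/tauPc.
Qed.

(** Applied to the expansion of [S], the derivation passes to the remainder, so
    its values are divisible by all powers of the shift. *)
Lemma derivation_eq0 delta : derivation_on A delta ->
  (forall j, delta (P j) = 0) -> delta U = 0 ->
  forall S, A S -> delta S = 0.
Proof.
move=> der dP dU S AS; apply: shiftX_divisible_eq0 => k.
have AU : A U by exact: graph_algebra_shift.
suff [T AT] : exists2 T, A T & delta S = U ^+ k * delta T by exists (delta T).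
elim: k => [|k [T AT ->]]; first by exists S => //; rewrite mul1r.
have AQ := graph_algebra_quotient AT.
exists (shift_quotient T) => //.
rewrite {1}(graph_algebra_expansion AT) (derivationD der); last first.
- exact: closed_algebraM.
- exact: graph_algebra_diag.
rewrite (derivationM der)// dU mul0r add0r.
rewrite (derivation_sum der) => [|j]; last first.
  by apply: closed_algebraZ; exact: graph_algebra_L_vertex.
rewrite big1 ?add0r => [|j _]; first by rewrite mulrA -exprSr.
by rewrite (derivationZ der) ?dP ?scaler0//; exact: graph_algebra_L_vertex.
Qed.

End circle_main.

Theorem proposition5p12 (R : realType) (n : nat) (n_ge1 : (1 <= n)%N)
    (delta : bop (l2 R (dpath (circle_graph n))) ->
             bop (l2 R (dpath (circle_graph n))))
    (der_delta : derivation_on (graph_algebra R (circle_graph n)) delta) :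
  exists2 T : bop (l2 R (dpath (circle_graph n))),
    graph_algebra R (circle_graph n) T &
    forall S, graph_algebra R (circle_graph n) S -> delta S = inner_derivation T S.
Proof.
have [T1 AT1 T1P] := derivation_vertex_inner der_delta.
have der1 := derivationB_inner der_delta AT1.
have dP1 j : delta (L_vertex R j) - inner_derivation T1 (L_vertex R j) = 0.
  by rewrite T1P subrr.
have [T2 [AT2 T2U T2P]] := derivation_shift_inner n_ge1 der1 dP1.
have der2 := derivationB_inner der1 AT2.
exists (T1 + T2) => [|S AS]; first exact: closed_algebraD.
have : delta S - inner_derivation T1 S - inner_derivation T2 S = 0.
  apply: (derivation_eq0 der2 _ _ AS) => [j|]; first by rewrite dP1 T2P subrr.
  by rewrite T2U subrr.
move=> /eqP; rewrite subr_eq0 subr_eq => /eqP ->.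
by rewrite addrC /inner_derivation mulrDr mulrDl opprD [RHS]addrACA.
Qed.
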